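(* Let $\{\xi_k,k\ge1\}$ be i.i.d. real random variables, and let $\{W_{nk}: n\ge1,\ 1\le k\le n\}$ be an array of real random variables independent of $\{\xi_k\}$. Suppose that (A3) $\frac1n\sum_{k=1}^nW_{nk}^2\stackrel{d}{\longrightarrow}W$ as $n\to\infty$, where $W$ is some non-negative random variable; (A4) $\lim_{c\to\infty}\sup_{n}\frac1n\sum_{k=1}^n\mathbb{E}\big(W_{nk}^2I(|W_{nk}|>c)\big)=0$. If $(a_n)$ is a sequence of positive constants such that $\frac{1}{a_n}\sum_{k=1}^n\xi_k\stackrel{d}{\longrightarrow}N(0,1)$, then $$\frac1{a_n}\sum_{k=1}^nW_{nk}\xi_k\stackrel{d}{\longrightarrow}\sqrt{W}\,N,$$ where $N$ is a standard normal random variable independent of $W$.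
   Context: The whole array $\{W_{nk}\}$ is independent of the whole sequence $\{\xi_k\}$; no independence or exchangeability among the weights $W_{nk}$ is assumed. $I(\cdot)$ is the indicator function. *)

(* Defs.v *)
From mathcomp Require Export all_boot all_order all_algebra.
From mathcomp Require Export finmap.
From mathcomp Require Export all_classical all_reals all_analysis.

Set Implicit Arguments.
Unset Strict Implicit.
Unset Printing Implicit Defensive.

Export Order.TTheory GRing.Theory Num.Theory.
Export numFieldNormedType.Exports.

#[export] Set Implicit Arguments.
#[export] Unset Strict Implicit.
#[export] Unset Printing Implicit Defensive.

Local Open Scope classical_set_scope.
Local Open Scope ring_scope.

(* Weak convergence of the laws of the X n to the law of Y, i.e. convergence
   of E f(X n) to E f(Y) for all bounded continuous f. The limit Y may live on
   another probability space; a given law mu on R is the limit when Y is the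
   identity of (R, mu). X and Y are plain functions so that formulas can be
   used directly: the definition is meant for measurable X n and Y. *)
Definition cvg_in_distribution (R : realType)
    (d : measure_display) (T : measurableType d) (P : probability T R)
    (X : nat -> T -> R)
    (d' : measure_display) (T' : measurableType d') (P' : probability T' R)
    (Y : T' -> R) : Prop :=
  forall f : R -> R, continuous f -> bounded_fun f ->
    ('E_P[f \o X n] @[n --> \oo] --> 'E_P'[f \o Y])%E.

Definition sigma_of_family (R : realType) (d : measure_display)
    (T : measurableType d) (P : probability T R) (I : Type)
    (X : I -> {RV P >-> R}) : set_system T :=
  <<s \bigcup_i preimage_set_system setT (X i) measurable >>.

Definition independent_families (R : realType) (d : measure_display)
    (T : measurableType d) (P : probability T R) (I J : Type)
    (X : I -> {RV P >-> R}) (Y : J -> {RV P >-> R}) : Prop :=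
  forall A B : set T, sigma_of_family X A -> sigma_of_family Y B ->
    P (A `&` B) = (P A * P B)%E.

Definition independent_RV2 (R : realType) (d : measure_display)
    (T : measurableType d) (P : probability T R) (X Y : {RV P >-> R}) : Prop :=
  forall A B : set R, measurable A -> measurable B ->
    P (X @^-1` A `&` Y @^-1` B) = (P (X @^-1` A) * P (Y @^-1` B))%E.

Definition mutually_independent (R : realType) (d : measure_display)
    (T : measurableType d) (P : probability T R) (I : choiceType)
    (X : I -> {RV P >-> R}) : Prop :=
  forall (J : {fset I}) (B : I -> set R), (forall i, measurable (B i)) ->
    P (\bigcap_(i in [set` J]) X i @^-1` B i) =
    (\prod_(i <- J) P (X i @^-1` B i))%E.

Definition identically_distributed (R : realType) (d : measure_display)
    (T : measurableType d) (P : probability T R) (I : Type)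
    (X : I -> {RV P >-> R}) : Prop :=
  forall (i j : I) (A : set R), measurable A ->
    distribution P (X i) A = distribution P (X j) A.

Definition iid (R : realType) (d : measure_display)
    (T : measurableType d) (P : probability T R) (I : choiceType)
    (X : I -> {RV P >-> R}) : Prop :=
  mutually_independent X /\ identically_distributed X.

Definition standard_normal (R : realType) (d : measure_display)
    (T : measurableType d) (P : probability T R) (N : {RV P >-> R}) : Prop :=
  forall A : set R, measurable A -> distribution P N A = normal_prob 0 1 A.

(* A triangular array with rows of length n; k : 'I_n is the 0-based position,
   so that W n k stands for the entry W_{n,k+1}. *)
Definition triangular_array (R : realType) (d : measure_display)
    (T : measurableType d) (P : probability T R) : Type :=
  forall n : nat, 'I_n -> {RV P >-> R}.

Definition array_entry (R : realType) (d : measure_display)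
    (T : measurableType d) (P : probability T R) (W : triangular_array P)
    (p : {n : nat & 'I_n}) : {RV P >-> R} := W (tag p) (tagged p).

(* The supremum over the rows n >= 1 of the averaged truncated second moments
   (1/n) sum_k E(W_nk^2 I(|W_nk| > c)), with values in [0, +oo]. *)
Definition sup_tail_second_moment (R : realType) (d : measure_display)
    (T : measurableType d) (P : probability T R) (W : triangular_array P)
    (c : R) : \bar R :=
  ereal_sup [set (n%:R^-1)%:E *
      \sum_(k < n) 'E_P[(fun w => W n k w ^+ 2 *
                                  \1_[set v | c < `|W n k v|] w)%R] |
    n in [set n : nat | (0 < n)%N]]%E.

(* Main.v *)
Require Import Defs.
From mathcomp Require Import measurable_realfun lra ring.

(* The proof goes through characteristic functions, written with real cosines
   and sines: [E cos (x + t X)], for all phases [x], carries the same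
   information as [E exp (i t X)].

   Let [A] and [B] be the real and imaginary parts of the characteristic
   function of [xi 0].  The central limit assumption says that
   [(A + iB)(t / a n) ^ n] tends to [exp (- t^2 / 2)], uniformly on compact
   sets.  Taking [n]-th roots (the branch is determined by continuity in [t])
   yields [n (1 - A (t / a n)) -> t^2 / 2] and [n B (t / a n) -> 0], uniformly
   on compact sets, and the duplication formulas bound
   [n |1 - (A + iB)(t w / a n)|] by a multiple of [w ^ 2] for [|w| >= 1].
   Hence, conditionally on the weights, the factors [(A + iB)(t W_nk / a n)]
   can be compared one by one with [exp (- t^2 W_nk^2 / (2 n))]: the weights
   bounded by [c] contribute [o(1)] and the others are controlled by the
   truncated second moments of (A4).  The expectation of the product of the
   latter factors converges by (A3).

   Convergence of characteristic functions to that of a given law implies weak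
   convergence: a Gaussian convolution of a test function is an integral of
   characters, test functions with compact support are uniformly close to their
   Gaussian convolutions, and no mass escapes to infinity since the limit is a
   probability. *)

Local Open Scope classical_set_scope.
Local Open Scope ring_scope.

(** * Integrals of bounded functions *)

Section integrable_EFin.
Context (R : realType) d (T : measurableType d) (mu : {measure set T -> \bar R}).
Context (D : set T) (mD : measurable D).
Implicit Types f g : T -> R.

Lemma integrable_EFinD f g : mu.-integrable D (EFin \o f) ->
  mu.-integrable D (EFin \o g) -> mu.-integrable D (EFin \o (fun x => f x + g x)).
Proof. by move=> intf intg; exact: (integrableD mD intf intg). Qed.

Lemma integrable_EFinB f g : mu.-integrable D (EFin \o f) ->
  mu.-integrable D (EFin \o g) -> mu.-integrable D (EFin \o (fun x => f x - g x)).
Proof. by move=> intf intg; exact: (integrableB mD intf intg). Qed.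

Lemma integrable_EFinZl f (c : R) : mu.-integrable D (EFin \o f) ->
  mu.-integrable D (EFin \o (fun x => c * f x)).
Proof. by move=> intf; exact: (integrableZl mD c intf). Qed.

End integrable_EFin.

Section bounded_functions.
Context (R : realType) d (T : measurableType d) (P : probability T R).
Implicit Types (f g : T -> R) (M : R).

Lemma bounded_integrable f M : measurable_fun setT f ->
  (forall x, `|f x| <= M) -> P.-integrable setT (EFin \o f).
Proof.
move=> mf fM; apply: (measurable_bounded_integrable _ _ mf) => //.
- by rewrite (le_lt_trans (probability_le1 _ _)) ?ltry.
- by exists M; split=> [|x Mx y _ /=]; rewrite ?num_real// (le_trans (fM y)) ?ltW.
Qed.

Lemma Rintegral_cstT c : \int[P]_x (cst c x) = c.
Proof.
by rewrite Rintegral_cst// [X in fine X]probability_setT mulr1.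
Qed.

Lemma expectation_Rintegral f M : measurable_fun setT f ->
  (forall x, `|f x| <= M) -> 'E_P[f]%E = (\int[P]_x f x)%:E.
Proof.
move=> mf fM; rewrite unlock /Rintegral fineK//.
exact: integrable_fin_num (bounded_integrable mf fM).
Qed.

Lemma le_bounded_Rintegral f M : measurable_fun setT f ->
  (forall x, `|f x| <= M) -> `|\int[P]_x f x| <= M.
Proof.
move=> mf fM; apply: (le_trans (le_normr_Rintegral _ _)) => //.
  exact: bounded_integrable mf fM.
rewrite -[leRHS](Rintegral_cstT M); apply: le_Rintegral => //.
- apply: (@bounded_integrable _ M); first exact: measurableT_comp.
  by move=> x; rewrite normr_id.
- by apply: (@bounded_integrable _ `|M|) => // x.
Qed.

(** Dominated convergence with the constant [M] as dominating function, integrable because [P] has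
    mass 1. *)
Lemma bounded_Rintegral_cvg (f_ : nat -> T -> R) f M :
  (forall n, measurable_fun setT (f_ n)) ->
  (forall n x, `|f_ n x| <= M) -> (forall x, f_ n x @[n --> \oo] --> f x) ->
  \int[P]_x f_ n x @[n --> \oo] --> \int[P]_x f x.
Proof.
move=> mf fM cf; apply: fine_cvg.
have mlim : measurable_fun setT f.
  apply: (measurable_fun_cvg mf) => x _; exact: cf.
have M0 : forall x, `|f x| <= M.
  move=> x; apply: (ler_cvg_to (cvg_norm (cf x)) (cvg_cst M)).
  by apply: nearW => n; exact: fM.
rewrite [X in _ --> X]fineK; last first.
  exact: integrable_fin_num (bounded_integrable mlim M0).
apply: (@dominated_cvg _ _ _ P _ _ _ _ (cst M%:E)) => //.
- by move=> n; exact/measurable_EFinP.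
- by move=> x _; apply: cvg_EFin; [exact: nearW|exact: cf].
- by apply: (@bounded_integrable (cst M) `|M|) => // x.
- by move=> n x _; rewrite lee_fin.
Qed.

End bounded_functions.

Section bounded_Fubini.
Context (R : realType) d1 (T1 : measurableType d1) d2 (T2 : measurableType d2).
Context (P1 : probability T1 R) (P2 : probability T2 R).
Variables (F : T1 * T2 -> R) (M : R).
Hypotheses (mF : measurable_fun setT F) (FM : forall z, `|F z| <= M).

Let iF : (P1 \x P2)%E.-integrable setT (EFin \o F).
Proof.
apply: (measurable_bounded_integrable _ _ mF) => //.
  rewrite -setXTT /= (product_measure1E P1 P2)//.
  by rewrite [X in (X * _)%E]probability_setT [X in (_ * X)%E]probability_setT mule1 ltry.
by exists M; split=> [|x Mx y _ /=]; rewrite ?num_real// (le_trans (FM y)) ?ltW.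
Qed.

Let iF1 y : P1.-integrable setT (EFin \o (fun x => F (x, y))).
Proof.
by apply: (bounded_integrable P1 _ (fun x => FM (x, y)));
  apply: (measurableT_comp mF); exact: measurable_pair2.
Qed.

Let iF2 x : P2.-integrable setT (EFin \o (fun y => F (x, y))).
Proof.
by apply: (bounded_integrable P2 _ (fun y => FM (x, y)));
  apply: (measurableT_comp mF); exact: measurable_pair1.
Qed.

Lemma measurable_bounded_Rintegral :
  measurable_fun setT (fun y => \int[P1]_x F (x, y)).
Proof.
apply/measurable_EFinP; apply: eq_measurable_fun (measurable_fubini_G iF) => y _.
by rewrite /fubini_G/= fineK//; exact: (integrable_fin_num measurableT (iF1 y)).
Qed.

Lemma bounded_Fubini :
  \int[P1]_x \int[P2]_y F (x, y) = \int[P2]_y \int[P1]_x F (x, y).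
Proof.
rewrite /Rintegral; congr fine.
transitivity (\int[P1]_x \int[P2]_y (EFin \o F) (x, y))%E.
  apply: eq_integral => x _; rewrite fineK//.
  exact: (integrable_fin_num measurableT (iF2 x)).
rewrite (@Fubini _ _ _ _ _ P1 P2 (EFin \o F) iF); apply: eq_integral => y _; rewrite fineK//.
exact: (integrable_fin_num measurableT (iF1 y)).
Qed.

Lemma bounded_Rintegral_prod :
  fine (\int[P1 \x P2]_z (F z)%:E)%E = \int[P1]_x \int[P2]_y F (x, y).
Proof.
rewrite /Rintegral -integral12_prod_meas1//; congr fine.
apply: eq_integral => x _; rewrite /fubini_F fineK//.
exact: (integrable_fin_num measurableT (iF2 x)).
Qed.

End bounded_Fubini.

(** * Independence and iterated integrals *)

Section independence.
Context (R : realType) d (T : measurableType d) (P : probability T R).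
Context d1 (T1 : measurableType d1) d2 (T2 : measurableType d2).
Variables (X : T -> T1) (Y : T -> T2).
Hypotheses (mX : measurable_fun setT X) (mY : measurable_fun setT Y).
Hypothesis XY : forall A B, measurable A -> measurable B ->
  P (X @^-1` A `&` Y @^-1` B) = (P (X @^-1` A) * P (Y @^-1` B))%E.

(** Independence on rectangles identifies the joint law with the product of the marginal laws, by
    uniqueness of the product measure, and Fubini does the rest. The target spaces are arbitrary
    because the lemma serves both for real variables and for identity maps into coarser
    sigma-algebras. *)
Lemma indep_Rintegral (F : T1 * T2 -> R) (M : R) : measurable_fun setT F ->
  (forall z, `|F z| <= M) ->
  \int[P]_w F (X w, Y w) = \int[P]_u \int[P]_v F (X u, Y v).
Proof.
move=> mF FM.
pose XX : {mfun T >-> T1} := mfun_Sub (mem_set mX).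
pose YY : {mfun T >-> T2} := mfun_Sub (mem_set mY).
have mXY : measurable_fun setT (fun w => (X w, Y w)).
  exact: measurable_fun_pair.
pose XY_ : {mfun T >-> (T1 * T2)%type} := mfun_Sub (mem_set mXY).
have int_comp d3 (T3 : measurableType d3) (Z : {mfun T >-> T3}) (G : T3 -> R) :
  measurable_fun setT G -> (forall z, `|G z| <= M) ->
  \int[P]_w G (Z w) = \int[distribution P Z]_z G z.
  move=> mG GM; rewrite /Rintegral; congr fine.
  rewrite (@integral_distribution _ _ _ _ _ P Z (EFin \o G))//.
    exact/measurable_EFinP.
  apply: (@bounded_integrable _ _ _ _ (G \o Z) M) => // [|x].
    exact: measurableT_comp.
  exact: GM.
have mF2 u : measurable_fun setT (fun v => F (u, v)).
  by apply: (measurableT_comp mF); exact: measurable_pair1.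
transitivity (\int[distribution P XY_]_z F z).
  by rewrite -int_comp.
transitivity (\int[distribution P XX]_x \int[distribution P YY]_y F (x, y)).
  rewrite -(bounded_Rintegral_prod (distribution P XX) (distribution P YY) mF FM).
  rewrite /Rintegral; congr fine.
  apply: eq_measure_integral => A mA _; apply/esym.
  by apply: product_measure_unique => // B C mB mC; exact: XY.
rewrite -(int_comp _ _ XX (fun x => \int[distribution P YY]_y F (x, y))).
- apply: eq_Rintegral => u _; rewrite -(int_comp _ _ YY (fun y => F (X u, y)))//.
- apply: (measurable_bounded_Rintegral (distribution P YY) (distribution P XX)
    (F := fun z => F (z.2, z.1)) (M := M)) => //.
  apply: (measurableT_comp mF); exact: measurable_fun_pair.
- by move=> x; apply: (@le_bounded_Rintegral _ _ _ (distribution P YY)).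
Qed.

End independence.

Section independent_sums.
Context (R : realType) d (T : measurableType d) (P : probability T R).
Variable xi : nat -> {RV P >-> R}.
Hypothesis xi_indep : mutually_independent xi.

(** A pi-system argument. The measure [m1] restricts [P] to the event that [xi m] lies in [B], and
    [m2] multiplies [P] by the probability of that event. They agree on the cylinders over [J] by
    mutual independence, hence on the sigma-algebra [<<s G >>], which contains the events about the
    sum. *)
Lemma indep_fset_sum (w : nat -> R) (J : {fset nat}) m (A B : set R) :
  m \notin J -> measurable A -> measurable B ->
  P ((fun v => \sum_(k <- J) w k * xi k v) @^-1` A `&` xi m @^-1` B) =
  (P ((fun v => (\sum_(k <- J) w k * xi k v)%R) @^-1` A) * P (xi m @^-1` B))%E.
Proof.
move=> mJ mA mB.
have mxi k C : measurable C -> measurable (xi k @^-1` C).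
  by move=> mC; rewrite -[X in measurable X]setTI; exact: measurable_funP.
pose G : set (set T) := [set E | exists2 C : nat -> set R,
  (forall i, measurable (C i)) & E = \bigcap_(i in [set` J]) xi i @^-1` C i].
have GT : G setT.
  exists (fun=> setT) => //; apply/esym; rewrite -subTset => x _ i _ //.
have GI : setI_closed G.
  move=> _ _ [C mC ->] [D mD ->]; exists (fun i => C i `&` D i).
    by move=> i; exact: measurableI.
  by rewrite -bigcapI.
have Gm : G `<=` measurable.
  move=> _ [C mC ->]; apply: fin_bigcap_measurable => // i _.
  exact: mxi.
have GS : <<s G >> ((fun v => \sum_(k <- J) w k * xi k v) @^-1` A).
  have : measurable_fun [set: g_sigma_algebraType G]
      (fun v : g_sigma_algebraType G => \sum_(k <- J) w k * xi k v).
    (* Indexing the sum by the finite type [J] keeps the membership proof of each index; it is what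
       makes the preimage under one [xi k] a cylinder over [J]. *)
    rewrite (_ : (fun v => _) = (fun v => \sum_(k : J) w (val k) * xi (val k) v)); last first.
      by apply/funext => v; rewrite big_seq_fsetE.
    apply: measurable_sum => k; apply: measurable_funM => //.
    move=> _ C mC; rewrite setTI; apply: sub_sigma_algebra.
    exists (fun i => if i == val k then C else setT).
      by move=> i; case: ifP.
    apply/seteqP; split=> x /=.
      by move=> Cx i _ /=; case: eqP => [->|].
    by move=> /(_ (val k) (valP k)); rewrite eqxx.
  by move=> /(_ measurableT A mA); rewrite setTI.
pose c : {nonneg R} := NngNum (fine_ge0 (measure_ge0 P (xi m @^-1` B))).
have cE : (c%:num)%:E = P (xi m @^-1` B).
  by rewrite /= fineK// fin_num_measure//; exact: mxi.
have mxiB := mxi m _ mB.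
pose m1 : {measure set T -> \bar R} := mrestr P mxiB.
pose m2 : {measure set T -> \bar R} := mscale c P.
suff : m1 ((fun v => \sum_(k <- J) w k * xi k v) @^-1` A) =
       m2 ((fun v => \sum_(k <- J) w k * xi k v) @^-1` A).
  by rewrite /m1 /m2 /= /mrestr /mscale cE muleC.
apply: (g_sigma_algebra_measure_unique G Gm (fun=> setT)) => //.
- by apply/seteqP; split=> // x _; exists 0%N.
- move=> _ [C mC ->]; rewrite /m1 /m2 /= /mrestr /mscale cE.
  (* [D] imposes the cylinder conditions on [J] and [B] at the new index [m], so that independence
     over [J] enlarged by [m] covers the intersection. *)
  pose D i := if i == m then B else C i.
  have mD i : measurable (D i) by rewrite /D; case: ifP.
  have DJ i : i \in J -> D i = C i.
    by move=> iJ; rewrite /D; case: eqP => // im; rewrite -im iJ in mJ.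
  have := xi_indep (m |` J)%fset mD.
  rewrite big_fsetU1//= /D eqxx => E.
  have E2 := xi_indep J mC.
  rewrite E2 -[X in (_ = X * _)%E](_ : P (xi m @^-1` B) = _)//.
  rewrite (eq_big_seq (fun i => P (xi i @^-1` D i))).
    rewrite -E; congr (P _); apply/seteqP; split=> x /=.
      move=> [Cx Bx] i /=; rewrite !inE => /predU1P[->|iJ].
        by rewrite /D eqxx.
      by rewrite -/(D i) DJ//; exact: Cx.
    move=> Dx; split.
      move=> i /= iJ; have := Dx i; rewrite /= -/(D i) DJ//; apply.
      by rewrite !inE iJ orbT.
    by have := Dx m; rewrite /= eqxx; apply; rewrite !inE eqxx.
  by move=> i iJ /=; rewrite DJ.
- by move=> k; rewrite /m1 /= /mrestr (le_lt_trans (probability_le1 _ _)) ?ltry//;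
    by rewrite setTI.
Qed.

Lemma measurable_lin_comb (J : seq nat) (w : nat -> R) :
  measurable_fun setT (fun v => \sum_(k <- J) w k * xi k v).
Proof.
by apply: measurable_sum => k; exact: measurable_funM.
Qed.

(** The addition formula splits off the last summand and independence factors the expectations. The
    free phase [x] keeps the induction closed: the sine on the right is again a cosine, with phase
    shifted by [pi / 2]. *)
Lemma Rintegral_cos_lin_combS (w : nat -> R) m x :
  \int[P]_v cos (x + \sum_(k < m.+1) w k * xi k v) =
  \int[P]_v cos (w m * xi m v) * \int[P]_v cos (x + \sum_(k < m) w k * xi k v) -
  \int[P]_v sin (w m * xi m v) * \int[P]_v sin (x + \sum_(k < m) w k * xi k v).
Proof.
pose S v := \sum_(k < m) w k * xi k v.
pose J := [fset k | k in iota 0 m]%fset.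
have SJ v : S v = \sum_(k <- J) w k * xi k v.
  rewrite /S -(big_mkord xpredT (fun k => w k * xi k v)) /index_iota subn0.
  apply: perm_big; apply: uniq_perm; rewrite ?iota_uniq ?fset_uniq//.
  by move=> i; rewrite !inE.
have mS : measurable_fun setT S.
  by rewrite (funext SJ); exact: measurable_lin_comb.
have mc : measurable_fun setT (@cos R).
  by apply: continuous_measurable_fun; exact: continuous_cos.
have ms : measurable_fun setT (@sin R).
  by apply: continuous_measurable_fun; exact: continuous_sin.
have b1 (f : R -> R) (g : T -> R) : (f = cos \/ f = sin) ->
    measurable_fun setT g -> P.-integrable setT (EFin \o (f \o g)).
  move=> [->|->] mg; apply: (@bounded_integrable _ _ _ _ _ 1);
    by [exact: measurableT_comp|move=> y; exact: cos_max|move=> y; exact: sin_max].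
have mxS : measurable_fun setT (fun v => x + S v) by exact: measurable_funD.
have mwx : measurable_fun setT (fun v => w m * xi m v) by exact: measurable_funM.
have XY A B : measurable A -> measurable B ->
  P (S @^-1` A `&` xi m @^-1` B) = (P (S @^-1` A) * P (xi m @^-1` B))%E.
  move=> mA mB; rewrite (funext SJ); apply: indep_fset_sum => //.
  by rewrite !inE mem_iota add0n ltnn andbF.
have -> : \int[P]_v cos (x + \sum_(k < m.+1) w k * xi k v) =
   \int[P]_u \int[P]_v cos (x + (S u + w m * xi m v)).
  rewrite -(indep_Rintegral mS (measurable_funPT (xi m)) XY
     (F := fun z => cos (x + (z.1 + w m * z.2))) (M := 1)).
  - by apply: eq_Rintegral => v _; rewrite big_ord_recr.
  - apply: measurableT_comp => //; apply: measurable_funD => //.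
    by apply: measurable_funD => //; apply: measurable_funM.
  - by move=> z; exact: cos_max.
rewrite -RintegralZl//; last by apply: (b1 cos) => //; left.
rewrite -RintegralZl//; last by apply: (b1 sin) => //; right.
rewrite -RintegralB//; last 2 first.
- by apply: integrable_EFinZl => //; apply: (b1 cos) => //; left.
- by apply: integrable_EFinZl => //; apply: (b1 sin) => //; right.
apply: eq_Rintegral => u _.
under eq_Rintegral do rewrite addrA cosD.
rewrite RintegralB//; last 2 first.
- by apply: integrable_EFinZl => //; apply: (b1 cos) => //; left.
- by apply: integrable_EFinZl => //; apply: (b1 sin) => //; right.
rewrite RintegralZl//; last by apply: (b1 cos) => //; left.
rewrite RintegralZl//; last by apply: (b1 sin) => //; right.
by rewrite mulrC [X in _ - X]mulrC.
Qed.

End independent_sums.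

(** * Trigonometric integrals of independent sums *)

Section elementary.
Context (R : realType).
Implicit Types x y : R.

Lemma cos_lipschitz x y : `|cos x - cos y| <= `|x - y|.
Proof.
wlog yx : x y / y < x.
  move=> H; have [xy|yx|->] := ltgtP x y; last by rewrite !subrr.
  - by rewrite distrC [leRHS]distrC; exact: H.
  - exact: H.
have [c _ ->] : exists2 c, c \in `]y, x[%R & cos x - cos y = - sin c * (x - y).
  apply: MVT => //; apply: continuous_subspaceT => z; exact: continuous_cos.
by rewrite normrM normrN ler_piMl// sin_max.
Qed.

Lemma sin_le_norm x : `|sin x| <= `|x|.
Proof.
have := cos_lipschitz (x - pi / 2) (- (pi / 2)).
by rewrite cosBpihalf cosN cos_pihalf subr0 opprK subrK.
Qed.

Lemma atan_le_norm x : `|atan x| <= `|x|.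
Proof.
wlog x0 : x / 0 < x.
  move=> H; have [x0|x0|->] := ltgtP x 0; last by rewrite atan0.
  - by rewrite -[X in atan X]opprK atanN normrN -[leRHS]normrN H// oppr_gt0.
  - exact: H.
have [c _] : exists2 c, c \in `]0, x[%R & atan x - atan 0 = (1 + c ^+ 2)^-1 * (x - 0).
  by apply: MVT => //; apply: continuous_subspaceT => z; exact: continuous_atan.
rewrite atan0 !subr0 => ->; rewrite normrM ler_piMl//.
by rewrite ger0_norm ?invr_ge0 ?invf_le1 ?addr_ge0 ?sqr_ge0// ?ltr_pwDl ?sqr_ge0// lerDl sqr_ge0.
Qed.

(** One doubling step is [1 - cos (2 y) = 2 (1 - cos y) (1 + cos y) <= 4 (1 - cos y)]. *)
Lemma cos_doubling k x : 1 - cos (2 ^+ k * x) <= 4 ^+ k * (1 - cos x).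
Proof.
elim: k => [|k IH]; first by rewrite !expr0 !mul1r.
rewrite !exprS -mulrA.
have := cos_mulr2n (2 ^+ k * x); rewrite mulr_natl => ->.
set c := cos _ in IH *.
have c1 : c <= 1 by exact: cos_le1.
have cN : -1 <= c by exact: cos_geN1.
rewrite -mulrA.
apply: le_trans (_ : 4 * (1 - c) <= _); last by rewrite ler_wpM2l.
nra.
Qed.

(** By [sin (2 y) = 2 sin y cos y], a doubling step doubles the previous error and adds
    [2 |s| (1 - c)], which [cos_doubling] controls. Each contribution is at most
    [2 * 4 ^ k * (1 - cos x)], and together they make the next power of 4. *)
Lemma sin_doubling k x :
  `|sin (2 ^+ k * x) - 2 ^+ k * sin x| <= 4 ^+ k * (1 - cos x).
Proof.
elim: k => [|k IH].
  by rewrite !expr0 !mul1r subrr normr0 subr_ge0 cos_le1.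
rewrite !exprS -!mulrA.
have -> : sin (2 * (2 ^+ k * x)) = 2 * (cos (2 ^+ k * x) * sin (2 ^+ k * x)).
  by rewrite !mulr_natl sin_mulr2n.
have := cos_doubling k x.
set c := cos (_ * x) in IH *; set s := sin (_ * x) in IH *.
move=> cd; have sm : `|s| <= 1 by exact: sin_max.
have c1 : c <= 1 by exact: cos_le1.
rewrite (_ : _ - _ = 2 * (s - 2 ^+ k * sin x) - 2 * (s * (1 - c))); last by ring.
apply: (le_trans (ler_normB _ _)); rewrite !normrM.
rewrite !(@ger0_norm _ 2)// (@ger0_norm _ (1 - c)) ?subr_ge0//.
have : `|s| * (1 - c) <= 1 - c by rewrite ler_piMl// subr_ge0.
move: IH cd; set u := `|s - _|; set v := _ * (1 - cos x); lra.
Qed.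

(** The lower bound [1 + y] of the exponential, used at [- y], gives [expR y <= 1 / (1 - y)], which
    exceeds [1 + y] by [y ^ 2 / (1 - y)]. *)
Lemma expR_quadratic y : `|y| <= 1 / 2 -> `|expR y - 1 - y| <= 2 * y ^+ 2.
Proof.
move=> y2; have := expR_ge1Dx y; have := expR_ge1Dx (- y).
rewrite expRN; set e := expR y => h1 h2.
have e0 : 0 < e by exact: expR_gt0.
have [ym yp] : - (1/2) <= y /\ y <= 1/2 by move: y2; rewrite ler_norml => /andP[].
have h3 : (1 - y) * e <= 1.
  have := ler_wpM2r (ltW e0) h1; rewrite mulVf ?gt_eqF//.
rewrite ger0_norm; last lra.
nra.
Qed.

Lemma exists_pow2_between (w : R) : 1 <= `|w| ->
  exists k : nat, `|w| <= 2 ^+ k /\ 2 ^+ k <= 2 * `|w|.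
Proof.
move=> w1; pose m := Num.trunc `|w|.
have m0 : (0 < m)%N by rewrite truncn_gt0.
have /andP[l1 l2] := trunc_log_bounds (ltnSn 1) m0.
have /andP[t1 t2] := truncn_itv (normr_ge0 w).
exists (trunc_log 2 m).+1; split.
  apply: (le_trans (ltW t2)).
  by rewrite -natrX ler_nat.
rewrite exprS ler_pM2l//; apply: le_trans t1.
by rewrite -natrX ler_nat.
Qed.

End elementary.

Section trig_integrals.
Context (R : realType) d (T : measurableType d) (P : probability T R).

Lemma measurable_cos_comp (X : T -> R) : measurable_fun setT X ->
  measurable_fun setT (cos \o X).
Proof.
by apply: measurableT_comp; apply: continuous_measurable_fun; exact: continuous_cos.
Qed.

Lemma measurable_sin_comp (X : T -> R) : measurable_fun setT X ->
  measurable_fun setT (sin \o X).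
Proof.
by apply: measurableT_comp; apply: continuous_measurable_fun; exact: continuous_sin.
Qed.

Lemma integrable_cos (X : T -> R) : measurable_fun setT X ->
  P.-integrable setT (EFin \o (fun w => cos (X w))).
Proof.
move=> mX; apply: (@bounded_integrable _ _ _ _ _ 1).
  exact: measurable_cos_comp.
by move=> y; exact: cos_max.
Qed.

Lemma integrable_sin (X : T -> R) : measurable_fun setT X ->
  P.-integrable setT (EFin \o (fun w => sin (X w))).
Proof.
move=> mX; apply: (@bounded_integrable _ _ _ _ _ 1).
  exact: measurable_sin_comp.
by move=> y; exact: sin_max.
Qed.

Lemma Rintegral_cos_max (X : T -> R) : measurable_fun setT X ->
  `|\int[P]_w cos (X w)| <= 1.
Proof.
move=> mX; apply: le_bounded_Rintegral; first exact: measurable_cos_comp.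
by move=> w; exact: cos_max.
Qed.

Lemma Rintegral_sin_max (X : T -> R) : measurable_fun setT X ->
  `|\int[P]_w sin (X w)| <= 1.
Proof.
move=> mX; apply: le_bounded_Rintegral; first exact: measurable_sin_comp.
by move=> w; exact: sin_max.
Qed.

(** A characteristic function has modulus at most 1. Integrating the pointwise bound
    [A cos + B sin <= (A ^ 2 + B ^ 2 + 1) / 2] makes [A ^ 2 + B ^ 2] appear on both sides. *)
Lemma Rintegral_cos2Dsin2_le1 (X : T -> R) : measurable_fun setT X ->
  (\int[P]_w cos (X w)) ^+ 2 + (\int[P]_w sin (X w)) ^+ 2 <= 1.
Proof.
move=> mX; set A := \int[P]_w cos _; set B := \int[P]_w sin _.
have iA : P.-integrable setT (EFin \o (fun w => A * cos (X w))).
  by apply: integrable_EFinZl => //;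
    exact: integrable_cos.
have iB : P.-integrable setT (EFin \o (fun w => B * sin (X w))).
  by apply: integrable_EFinZl => //;
    exact: integrable_sin.
have : \int[P]_w (A * cos (X w) + B * sin (X w)) <= (A ^+ 2 + B ^+ 2 + 1) / 2.
  rewrite -[leRHS](Rintegral_cstT P); apply: le_Rintegral => //.
  - exact: integrable_EFinD.
  - exact: (@bounded_integrable _ _ _ _ _ `|(A ^+ 2 + B ^+ 2 + 1) / 2|).
  - move=> w _ /=; have := cos2Dsin2 (X w); have := sqr_ge0 (A - cos (X w)).
    by have := sqr_ge0 (B - sin (X w)); nra.
rewrite RintegralD// RintegralZl ?RintegralZl//; [|exact: integrable_sin|exact: integrable_cos].
by rewrite -/A -/B; nra.
Qed.

Lemma Rintegral_cos_doubling (X : T -> R) k : measurable_fun setT X ->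
  1 - \int[P]_w cos (2 ^+ k * X w) <= 4 ^+ k * (1 - \int[P]_w cos (X w)).
Proof.
move=> mX; have m2X : measurable_fun setT (fun w => 2 ^+ k * X w).
  exact: measurable_funM.
have i1 : P.-integrable setT (EFin \o (fun=> (1:R))).
  exact: (@bounded_integrable _ _ _ _ _ `|1|).
rewrite -[X in X - _ <= _](Rintegral_cstT P) -[X in _ * (X - _)](Rintegral_cstT P).
rewrite -RintegralB//; last exact: integrable_cos.
rewrite -RintegralB//; last exact: integrable_cos.
have i2 : P.-integrable setT (EFin \o (fun w => 1 - cos (X w))).
  by apply: integrable_EFinB => //; exact: integrable_cos.
rewrite -RintegralZl//; apply: le_Rintegral => //.
- by apply: integrable_EFinB => //; exact: integrable_cos.
- exact: integrable_EFinZl.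
- by move=> w _; exact: cos_doubling.
Qed.

Lemma Rintegral_sin_doubling (X : T -> R) k : measurable_fun setT X ->
  `|\int[P]_w sin (2 ^+ k * X w)| <=
  2 ^+ k * `|\int[P]_w sin (X w)| + 4 ^+ k * (1 - \int[P]_w cos (X w)).
Proof.
move=> mX; have m2X : measurable_fun setT (fun w => 2 ^+ k * X w).
  exact: measurable_funM.
have i1 : P.-integrable setT (EFin \o (fun=> (1:R))).
  exact: (@bounded_integrable _ _ _ _ _ `|1|).
have is2 : P.-integrable setT (EFin \o (fun w => 2 ^+ k * sin (X w))).
  by apply: integrable_EFinZl => //;
    exact: integrable_sin.
have i2 : P.-integrable setT (EFin \o (fun w => 1 - cos (X w))).
  by apply: integrable_EFinB => //; exact: integrable_cos.
have id : P.-integrable setT (EFin \o (fun w => sin (2 ^+ k * X w) - 2 ^+ k * sin (X w))).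
  by apply: integrable_EFinB => //; exact: integrable_sin.
have -> : \int[P]_w sin (2 ^+ k * X w) = 2 ^+ k * \int[P]_w sin (X w) +
    \int[P]_w (sin (2 ^+ k * X w) - 2 ^+ k * sin (X w)).
  rewrite RintegralB//; last exact: integrable_sin.
  by rewrite RintegralZl//; [ring|exact: integrable_sin].
apply: (le_trans (ler_normD _ _)); rewrite normrM ger0_norm ?exprn_ge0//.
rewrite lerD2l; apply: (le_trans (le_normr_Rintegral _ _)) => //.
rewrite -[X in _ * (X - _)](Rintegral_cstT P) -RintegralB//; last exact: integrable_cos.
rewrite -RintegralZl//; apply: le_Rintegral => //.
- exact: (integrable_norm id).
- exact: integrable_EFinZl.
- by move=> w _; exact: sin_doubling.
Qed.

Lemma Rintegral_sin_cos (X : T -> R) x : 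
  \int[P]_w sin (x + X w) = \int[P]_w cos (x - pi / 2 + X w).
Proof. by apply: eq_Rintegral => w _; rewrite addrAC cosBpihalf. Qed.

End trig_integrals.

Section iid_sums.
Context (R : realType) d (T : measurableType d) (P : probability T R).
Variable xi : nat -> {RV P >-> R}.

Lemma identically_distributed_Rintegral (f : R -> R) k M :
  identically_distributed xi -> measurable_fun setT f -> (forall x, `|f x| <= M) ->
  \int[P]_w f (xi k w) = \int[P]_w f (xi 0%N w).
Proof.
move=> xid mf fM.
have E i : \int[P]_w f (xi i w) = \int[distribution P (xi i)]_z f z.
  rewrite /Rintegral; congr fine.
  rewrite (@integral_distribution _ _ _ _ _ P (xi i) (EFin \o f))//.
    exact/measurable_EFinP.
  apply: (@bounded_integrable _ _ _ _ (f \o xi i) M) => // [|x].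
    exact: measurableT_comp.
  exact: fM.
rewrite !E /Rintegral; congr fine; apply: eq_measure_integral => A mA _.
exact: xid.
Qed.

Hypothesis xi_indep : mutually_independent xi.

(** Telescoping comparison of two products, one factor at a time: all factors have modulus at most
    1, so the errors add up. The factors [z k] are real, hence the sine integral enters entirely as
    an error. *)
Lemma cos_lin_comb_bound (w z : nat -> R) m x : (forall k, 0 <= z k <= 1) ->
  `|\int[P]_v cos (x + \sum_(k < m) w k * xi k v) - cos x * \prod_(k < m) z k| <=
  \sum_(k < m) (`|\int[P]_v cos (w k * xi k v) - z k| + `|\int[P]_v sin (w k * xi k v)|).
Proof.
move=> z01; elim: m => [|m IH].
  rewrite !big_ord0 mulr1; under eq_Rintegral do rewrite big_ord0 addr0.
  by rewrite (Rintegral_cstT P (cos x)) subrr normr0.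
rewrite Rintegral_cos_lin_combS// big_ord_recr/= [leRHS]big_ord_recr/=.
set A := \int[P]_v cos (w m * _); set B := \int[P]_v sin (w m * _).
move: IH; set C := \int[P]_v _; set p := \prod_(k < m) _; set S := \sum_(k < m) _ => IH.
set D := \int[P]_v _.
have mS : measurable_fun setT (fun v => x + \sum_(k < m) w k * xi k v).
  apply: measurable_funD => //; apply: measurable_sum => k.
  exact: measurable_funM.
have C1 : `|C| <= 1 by exact: Rintegral_cos_max.
have D1 : `|D| <= 1 by exact: Rintegral_sin_max.
rewrite (_ : _ - _ = z m * (C - cos x * p) + ((A - z m) * C - B * D)); last by ring.
apply: (le_trans (ler_normD _ _)); apply: lerD.
  rewrite normrM; apply: le_trans IH; rewrite ler_piMl//.
  by have /andP[z0 z1] := z01 m; rewrite ger0_norm.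
apply: (le_trans (ler_normB _ _)); rewrite !normrM.
by apply: lerD; rewrite ler_piMr.
Qed.

Hypothesis xi_id : identically_distributed xi.

(** De Moivre's formula for the characteristic function of the sum. Any polar form of the common
    factor is allowed, so the choice of the argument [al] is left to the user of the lemma. *)
Lemma Rintegral_cos_sum_polar s r al x n :
  \int[P]_w cos (s * xi 0%N w) = r * cos al ->
  \int[P]_w sin (s * xi 0%N w) = r * sin al ->
  \int[P]_v cos (x + s * \sum_(k < n) xi k v) = r ^+ n * cos (x + n%:R * al).
Proof.
move=> cE sE.
have cEk k : \int[P]_w cos (s * xi k w) = r * cos al.
  rewrite -cE (@identically_distributed_Rintegral (fun u => cos (s * u)) k 1)//.
    by apply: measurable_cos_comp; exact: measurable_funM.
  by move=> u; exact: cos_max.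
have sEk k : \int[P]_w sin (s * xi k w) = r * sin al.
  rewrite -sE (@identically_distributed_Rintegral (fun u => sin (s * u)) k 1)//.
    by apply: measurable_sin_comp; exact: measurable_funM.
  by move=> u; exact: sin_max.
elim: n x => [|n IH] x.
  under eq_Rintegral do rewrite big_ord0 mulr0 addr0.
  by rewrite (Rintegral_cstT P (cos x)) expr0 mul1r mul0r addr0.
under eq_Rintegral do rewrite mulr_sumr.
rewrite (Rintegral_cos_lin_combS xi_indep (fun=> s)).
rewrite cEk sEk; under eq_Rintegral do rewrite -mulr_sumr.
rewrite IH; under eq_Rintegral do rewrite -mulr_sumr.
rewrite Rintegral_sin_cos IH addrAC cosBpihalf exprS -natr1 mulrDl mul1r addrA [X in _ = _ * X]cosD.
ring.
Qed.

(** Multiplicativity of the squared modulus, from [(A C - B D) ^ 2 + (A D + B C) ^ 2 = (A ^ 2 + B ^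
    2) (C ^ 2 + D ^ 2)]; no argument has to be chosen. The sine is carried as the cosine with phase
    [- (pi / 2)]. *)
Lemma Rintegral_cos2Dsin2_sum s n :
  (\int[P]_v cos (s * \sum_(k < n) xi k v)) ^+ 2 +
  (\int[P]_v sin (s * \sum_(k < n) xi k v)) ^+ 2 =
  ((\int[P]_w cos (s * xi 0%N w)) ^+ 2 +
   (\int[P]_w sin (s * xi 0%N w)) ^+ 2) ^+ n.
Proof.
have cEk k : \int[P]_w cos (s * xi k w) = \int[P]_w cos (s * xi 0%N w).
  apply: (@identically_distributed_Rintegral (fun u => cos (s * u)) k 1) => //.
    by apply: measurable_cos_comp; exact: measurable_funM.
  by move=> u; exact: cos_max.
have sEk k : \int[P]_w sin (s * xi k w) = \int[P]_w sin (s * xi 0%N w).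
  apply: (@identically_distributed_Rintegral (fun u => sin (s * u)) k 1) => //.
    by apply: measurable_sin_comp; exact: measurable_funM.
  by move=> u; exact: sin_max.
have sc m : \int[P]_v sin (s * \sum_(k < m) xi k v) =
    \int[P]_v cos (- (pi / 2) + s * \sum_(k < m) xi k v).
  by apply: eq_Rintegral => v _; rewrite addrC cosBpihalf.
rewrite sc.
have cc m : \int[P]_v cos (s * \sum_(k < m) xi k v) =
    \int[P]_v cos (0 + s * \sum_(k < m) xi k v).
  by apply: eq_Rintegral => v _; rewrite add0r.
rewrite cc; elim: n => [|n IH].
  under eq_Rintegral do rewrite big_ord0 mulr0 addr0.
  under [X in _ + X ^+ 2]eq_Rintegral do rewrite big_ord0 mulr0 addr0.
  rewrite (Rintegral_cstT P (cos 0)) (Rintegral_cstT P (cos (- (pi / 2)))).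
  by rewrite cosN cos_pihalf cos0 expr0n/= addr0 expr1n expr0.
have rec x : \int[P]_v cos (x + s * \sum_(k < n.+1) xi k v) =
   (\int[P]_w cos (s * xi 0%N w)) * (\int[P]_v cos (x + s * \sum_(k < n) xi k v))
   - (\int[P]_w sin (s * xi 0%N w)) * (\int[P]_v sin (x + s * \sum_(k < n) xi k v)).
  under eq_Rintegral do rewrite mulr_sumr.
  rewrite (Rintegral_cos_lin_combS xi_indep (fun=> s)) cEk sEk.
  by congr (_ * _ - _ * _); apply: eq_Rintegral => v _; rewrite mulr_sumr.
rewrite [RHS]exprS -IH !rec.
have -> : \int[P]_v sin (- (pi / 2) + s * \sum_(k < n) xi k v) =
    - \int[P]_v cos (0 + s * \sum_(k < n) xi k v).
  rewrite -[RHS]mulN1r -RintegralZl//.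
    by apply: eq_Rintegral => v _; rewrite add0r addrC sinBpihalf mulN1r.
  apply: integrable_cos; apply: measurable_funD => //; apply: measurable_funM => //.
  by apply: measurable_sum.
have -> : \int[P]_v sin (0 + s * \sum_(k < n) xi k v) =
    \int[P]_v cos (- (pi / 2) + s * \sum_(k < n) xi k v).
  by rewrite Rintegral_sin_cos; apply: eq_Rintegral => v _; rewrite add0r.
ring.
Qed.

End iid_sums.

(** * The normal distribution *)

Section integral_derivative.
Context (R : realType).
Notation mu := (@lebesgue_measure R).

(** The fundamental theorem of calculus evaluates the integrals over [[-n, n]], and dominated
    convergence passes to the whole line. *)
Lemma Rintegral_derivative_eq0 (G g : R -> R) :
  (forall z : R, is_derive z 1 G (g z)) -> continuous g ->
  mu.-integrable setT (EFin \o g) ->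
  G n%:R @[n --> \oo] --> 0 -> G (- n%:R) @[n --> \oo] --> 0 ->
  \int[mu]_z g z = 0.
Proof.
move=> dG cg ig Gp Gm.
have cG : continuous G.
  by move=> z; apply/differentiable_continuous/derivable1_diffP; exact: ex_derive.
pose h n := g \_ (`[- n%:R, n%:R]).
have hE n : (0 < n)%N -> \int[mu]_z h n z = G n%:R - G (- n%:R).
  move=> n0; rewrite /h -Rintegral_mkcond /Rintegral (@continuous_FTC2 _ g G)//.
  - by rewrite (@lt_trans _ _ 0)// ?oppr_lt0 ltr0n.
  - exact: continuous_subspaceT.
  - split.
    + by move=> x _; exact: ex_derive.
    + exact/cvg_at_right_filter/cG.
    + exact/cvg_at_left_filter/cG.
  - by move=> x _; rewrite derive1E derive_val.
have mg : measurable_fun setT g by exact: continuous_measurable_fun.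
have h1 : \int[mu]_z h n z @[n --> \oo] --> \int[mu]_z g z.
  apply: fine_cvg; rewrite fineK; last exact: integrable_fin_num.
  apply: (@dominated_cvg _ _ _ mu _ _ _ _ (EFin \o (fun z => `|g z|))) => //.
  - move=> n; apply/measurable_EFinP.
    by apply/(measurable_restrictT _ _).1 => //; exact: measurable_funTS.
  - move=> x _; apply: cvg_EFin; first exact: nearW.
    apply: cvg_near_cst.
    near=> n; rewrite /= /h patchE mem_set//= in_itv/= -ler_norml.
    by near: n; exact: nbhs_infty_ger.
  - exact: integrable_norm.
  - move=> n x _; rewrite lee_fin /h patchE; case: ifP => //.
    by rewrite normr0.
have h2 : \int[mu]_z h n z @[n --> \oo] --> 0.
  rewrite -[X in _ --> X](subr0 0); apply: cvg_trans (cvgB Gp Gm).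
  apply: near_eq_cvg; near=> n; rewrite hE//.
  by near: n; exact: nbhs_infty_gt.
exact: (cvg_unique _ h1 h2).
Unshelve. all: by end_near. Qed.

End integral_derivative.

Section normal.
Context (R : realType).
Notation mu := (@lebesgue_measure R).
Implicit Types m s x y z : R.

(** [normal_prob] integrates its density over sets, so its Radon-Nikodym derivative is almost
    everywhere [normal_pdf], and the change of variables applies. *)
Lemma Rintegral_normal_prob m s (f : R -> R) (M : R) : measurable_fun setT f ->
  (forall x, `|f x| <= M) ->
  \int[normal_prob m s]_x f x = \int[mu]_x (f x * normal_pdf m s x).
Proof.
move=> mf fM; rewrite /Rintegral; congr fine.
have ip := @bounded_integrable _ _ _ (normal_prob m s) _ _ mf fM.
rewrite -(Radon_Nikodym_change_of_variables (normal_prob_dominates m s))//=.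
apply: ae_eq_integral => //.
- apply: emeasurable_funM => //; first exact/measurable_EFinP.
  apply: (measurable_int mu).
  by apply: Radon_Nikodym_integrable; exact: normal_prob_dominates.
- apply/measurable_EFinP/measurable_funM => //.
  exact: measurable_normal_pdf.
- rewrite (_ : (fun x => (f x * _)%:E) = (fun x => (f x)%:E * (normal_pdf m s x)%:E)%E)//.
  apply: ae_eqe_mul2l => /=.
  rewrite Radon_NikodymE//=; first exact: normal_prob_dominates.
  move=> abmu; case: cid => /= h [h1 h2 h3].
  apply: integral_ae_eq => //=.
  + by apply/measurable_EFinP; exact: measurable_normal_pdf.
  + by move=> E E01 mE; rewrite -h3.
Qed.

Lemma normal_peak_sqrt2 s : 0 < s ->
  Num.sqrt 2 * normal_peak (Num.sqrt 2 * s) = normal_peak s.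
Proof.
move=> s0; rewrite /normal_peak exprMn sqr_sqrtr// -mulrA -mulrnAr sqrtrM//.
by rewrite invfM mulrA divff ?mul1r// gt_eqF// sqrtr_gt0.
Qed.

(** Half of the Gaussian exponent absorbs the linear factor: the exponential is [expR (- q)]
    squared, and [|y - x| <= s (1 + q) <= s expR q]. What remains is a normal density of deviation
    [Num.sqrt 2 * s], so first absolute moments are controlled by total masses. *)
Lemma normal_pdf_abs_le x s y : 0 < s ->
  `|y - x| * normal_pdf x s y <=
  Num.sqrt 2 * s * normal_pdf x (Num.sqrt 2 * s) y.
Proof.
move=> s0; have s20 : 0 < Num.sqrt 2 * s by rewrite mulr_gt0// sqrtr_gt0.
rewrite !normal_pdfE ?gt_eqF//.
rewrite (_ : _ * s * _ = s * (normal_peak s * normal_fun x (Num.sqrt 2 * s) y)); last first.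
  by rewrite -(normal_peak_sqrt2 s0); ring.
rewrite [leLHS]mulrCA [leRHS]mulrCA ler_wpM2l// ?normal_peak_ge0//.
set q := (y - x) ^+ 2 / (s ^+ 2 *+ 4).
have -> : normal_fun x s y = expR (- q) * expR (- q).
  rewrite -expRD /normal_fun; congr expR; rewrite /q.
  by field; rewrite gt_eqF.
have -> : normal_fun x (Num.sqrt 2 * s) y = expR (- q).
  rewrite /normal_fun exprMn sqr_sqrtr//; congr expR; rewrite /q.
  by field; rewrite gt_eqF.
rewrite mulrA ler_wpM2r ?expR_ge0// expRN ler_pdivrMr ?expR_gt0//.
apply: le_trans (_ : s * (1 + q) <= _); last first.
  by rewrite ler_wpM2l ?expR_ge1Dx// ltW.
have -> : s * (1 + q) = s + `|y - x| ^+ 2 / (4 * s).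
  by rewrite real_normK ?num_real// /q; field; rewrite gt_eqF.
rewrite -(ler_pM2r (_ : 0 < 4 * s)); last by rewrite mulr_gt0.
rewrite [leRHS]mulrDl divfK; last by rewrite gt_eqF// mulr_gt0.
have := sqr_ge0 (2 * s - `|y - x|); lra.
Qed.

Lemma integrable_abs_normal_pdf x s : 0 < s ->
  mu.-integrable setT (EFin \o (fun y => `|y - x| * normal_pdf x s y)).
Proof.
move=> s0; apply: (le_integrable measurableT _ _
  (integrable_EFinZl measurableT (Num.sqrt 2 * s) (integrable_normal_pdf x (Num.sqrt 2 * s)))).
  apply/measurable_EFinP/measurable_funM; last exact: measurable_normal_pdf.
  by apply: measurableT_comp => //; exact: measurable_funB.
move=> y _ /=; rewrite lee_fin ger0_norm ?mulr_ge0 ?normal_pdf_ge0//.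
by rewrite (le_trans _ (ler_norm _))// normal_pdf_abs_le.
Qed.

Lemma Rintegral_abs_normal_pdf x s : 0 < s ->
  \int[mu]_y (`|y - x| * normal_pdf x s y) <= Num.sqrt 2 * s.
Proof.
move=> s0.
apply: le_trans (_ : \int[mu]_y (Num.sqrt 2 * s * normal_pdf x (Num.sqrt 2 * s) y) <= _).
  apply: le_Rintegral => //.
  - exact: integrable_abs_normal_pdf.
  - by apply: integrable_EFinZl => //; exact: integrable_normal_pdf.
  - by move=> y _; exact: normal_pdf_abs_le.
rewrite RintegralZl//; last exact: integrable_normal_pdf.
by rewrite /Rintegral integral_normal_pdf/= mulr1.
Qed.

Lemma normal_pdf01E z : normal_pdf 0 1 z = normal_peak 1 * expR (- (z ^+ 2 / 2)).
Proof. by rewrite normal_pdfE// /normal_fun subr0 expr1n mulNr. Qed.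

Lemma is_derive_normal_pdf01 z :
  is_derive z 1 (normal_pdf 0 1) (- z * normal_pdf 0 1 z).
Proof.
rewrite (_ : normal_pdf 0 1 = fun z => normal_peak 1 * expR (- (z ^+ 2 / 2))); last first.
  by apply/funext => u; exact: normal_pdf01E.
apply: is_derive_eq.
rewrite /GRing.scale/=.
by field.
Qed.

Lemma cvg_normal_pdf01 (e : R) : e ^+ 2 = 1 ->
  normal_pdf 0 1 (e * n%:R) @[n --> \oo] --> 0.
Proof.
move=> e1.
apply: (@squeeze_cvgr _ _ _ _ (fun=> 0) (fun n => normal_peak 1 * (2 * n.+1%:R^-1))).
- apply: nearW => n; rewrite normal_pdf_ge0/= normal_pdf01E ler_wpM2l ?normal_peak_ge0//.
  (* The sign [e] serves both ends of the line; the bound rests on [expR (n ^ 2 / 2) >= 1 + n ^ 2 /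
     2 >= (n + 1) / 2]. *)
  rewrite expRN exprMn e1 mul1r -[leRHS]invrK lef_pV2 ?posrE ?expR_gt0 ?invr_gt0 ?mulr_gt0//.
  rewrite invfM invrK; apply: le_trans (expR_ge1Dx _).
  rewrite -[n.+1%:R]natr1; have := sqr_ge0 (n%:R - 1 / 2 : R); lra.
- exact: cvg_cst.
- rewrite -[X in _ --> X](mulr0 (normal_peak 1)); apply: cvgMr.
  rewrite -[X in _ --> X](mulr0 2); apply: cvgMr.
  exact: cvg_harmonic.
Qed.

Let p z := normal_pdf 0 1 z.

Let F x s := \int[mu]_z (cos (x + s * z) * p z).

Let measurable_lin x s : measurable_fun setT (fun z : R => x + s * z).
Proof. by apply: measurable_funD => //; exact: measurable_funM. Qed.

Let integrable_Cp (f : R -> R) : measurable_fun setT f -> (forall z, `|f z| <= 1) ->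
  mu.-integrable setT (EFin \o (fun z => f z * p z)).
Proof.
move=> mf f1; apply: (le_integrable measurableT _ _ (integrable_normal_pdf 0 1)).
  by apply/measurable_EFinP/measurable_funM => //; exact: measurable_normal_pdf.
move=> y _ /=; rewrite lee_fin normrM (ger0_norm (normal_pdf_ge0 _ _ _)).
by rewrite ler_piMl ?normal_pdf_ge0.
Qed.

Let integrable_zCp (f : R -> R) : measurable_fun setT f -> (forall z, `|f z| <= 1) ->
  mu.-integrable setT (EFin \o (fun z => f z * (z * p z))).
Proof.
move=> mf f1; apply: (le_integrable measurableT _ _ (integrable_abs_normal_pdf 0 ltr01)).
  by apply/measurable_EFinP/measurable_funM => //; apply: measurable_funM => //;
    exact: measurable_normal_pdf.
move=> y _ /=; rewrite lee_fin !normrM (ger0_norm (normal_pdf_ge0 _ _ _)) subr0.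
by rewrite normr_id ler_piMl// mulr_ge0// normal_pdf_ge0.
Qed.

Let mcos x s : measurable_fun setT (fun z : R => cos (x + s * z)).
Proof. by apply: measurable_cos_comp; exact: measurable_lin. Qed.

Let msin x s : measurable_fun setT (fun z : R => sin (x + s * z)).
Proof. by apply: measurable_sin_comp; exact: measurable_lin. Qed.

Let cp : continuous p.
Proof. exact: continuous_normal_pdf (oner_neq0 _). Qed.

(** The function [sin (x + s z) p z] vanishes at both ends, so its derivative integrates to 0; the
    density satisfies [p' = - z p]. *)
Let by_parts x s : \int[mu]_z (sin (x + s * z) * (z * p z)) = s * F x s.
Proof.
have clin : continuous (fun z : R => x + s * z).
  by move=> z; apply: cvgD; [exact: cvg_cst|apply: cvgMr; exact: cvg_id].
have cc : continuous (fun z : R => cos (x + s * z)).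
  by move=> z; apply: continuous_comp; [exact: clin|exact: continuous_cos].
have cs : continuous (fun z : R => sin (x + s * z)).
  by move=> z; apply: continuous_comp; [exact: clin|exact: continuous_sin].
have i1 : mu.-integrable setT (EFin \o (fun z => s * (cos (x + s * z) * p z))).
  by apply: integrable_EFinZl => //; apply: integrable_Cp => // z; exact: cos_max.
have i2 : mu.-integrable setT (EFin \o (fun z => sin (x + s * z) * (z * p z))).
  by apply: integrable_zCp => // z; exact: sin_max.
have : \int[mu]_z (s * (cos (x + s * z) * p z) - sin (x + s * z) * (z * p z)) = 0.
  apply: (@Rintegral_derivative_eq0 _ (fun z => sin (x + s * z) * p z)).
  - move=> z; have dp : is_derive z 1 p (- z * p z) by exact: is_derive_normal_pdf01.
    apply: is_derive_eq; rewrite /GRing.scale/=.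
    by ring.
  - move=> z; apply: cvgB.
      by apply: cvgMr; apply: cvgM; [exact: cc|exact: cp].
    by apply: cvgM; [exact: cs|apply: cvgM; [exact: cvg_id|exact: cp]].
  - exact: integrable_EFinB.
  - apply: norm_cvg0; apply: (@squeeze_cvgr _ _ _ _ (fun=> 0) (fun n => p (1 * n%:R))).
    + apply: nearW => n; rewrite normr_ge0/= normrM mul1r.
      by rewrite (ger0_norm (normal_pdf_ge0 _ _ _)) ler_piMl ?normal_pdf_ge0// sin_max.
    + exact: cvg_cst.
    + by apply: cvg_normal_pdf01; rewrite expr1n.
  - apply: norm_cvg0; apply: (@squeeze_cvgr _ _ _ _ (fun=> 0) (fun n => p (-1 * n%:R))).
    + apply: nearW => n; rewrite normr_ge0/= normrM mulN1r.
      by rewrite (ger0_norm (normal_pdf_ge0 _ _ _)) ler_piMl ?normal_pdf_ge0// sin_max.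
    + exact: cvg_cst.
    + by apply: cvg_normal_pdf01; rewrite sqrrN expr1n.
rewrite RintegralB// RintegralZl//; last first.
  by apply: integrable_Cp => // z; exact: cos_max.
by move=> /eqP; rewrite subr_eq0 => /eqP.
Qed.

(** Differentiation under the integral sign, dominated by [|z| p z], followed by [by_parts]. *)
Let is_derive_F x s : is_derive s 1 (F x) (- s * F x s).
Proof.
pose f (s z : R) := cos (x + s * z) * p z.
have df (u z : R) : is_derive u 1 (f ^~ z) (- (sin (x + u * z) * (z * p z))).
  by apply: is_derive_eq; rewrite /GRing.scale/=; ring.
have If (u : R) : `]s - 1, s + 1[%classic u -> mu.-integrable setT (EFin \o f u).
  by move=> _; apply: integrable_Cp => // z; exact: cos_max.
have Is : `]s - 1, s + 1[%classic s.
  by rewrite /= in_itv/= ltrBlDr ltrDl ltr01.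
have pE (u z : R) : partial1of2 f u z = - (sin (x + u * z) * (z * p z)).
  by rewrite partial1of2E derive_val.
have G0 (z : R) : 0 <= `|z - 0| * p z by rewrite mulr_ge0// normal_pdf_ge0.
have Gub (u z : R) : `]s - 1, s + 1[%classic u -> setT z ->
    `|partial1of2 f u z| <= `|z - 0| * p z.
  move=> _ _; rewrite pE normrN !normrM subr0 (ger0_norm (normal_pdf_ge0 _ _ _)).
  by rewrite ler_piMl ?mulr_ge0 ?normal_pdf_ge0 ?sin_max.
have Df (u z : R) : `]s - 1, s + 1[%classic u -> setT z -> derivable (f ^~ z) u 1.
  by move=> _ _; exact: ex_derive.
have dF := derivable_under_integral measurableT Is If Df G0
  (integrable_abs_normal_pdf 0 ltr01) Gub.
have := differentiation_under_integral measurableT Is If Df G0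
  (integrable_abs_normal_pdf 0 ltr01) Gub.
rewrite derive1E => dE; apply: DeriveDef => //; rewrite dE.
under eq_Rintegral do rewrite pE -mulN1r.
rewrite RintegralZl//; last by apply: integrable_zCp => // z; exact: sin_max.
by rewrite by_parts; ring.
Qed.

(** By [is_derive_F] the product of [F x s] and [expR (s ^ 2 / 2)] is constant in [s], and at
    [s = 0] it equals [cos x]. *)
Lemma normal_cf x s :
  \int[normal_prob 0 1]_z cos (x + s * z) = cos x * expR (- (s ^+ 2 / 2)).
Proof.
rewrite (Rintegral_normal_prob 0 1 (mcos x s) (M := 1)); last by move=> z; exact: cos_max.
have : F x s * expR (s ^+ 2 / 2) = F x 0 * expR (0 ^+ 2 / 2).
  apply: (@is_derive_0_is_cst _ (fun s => F x s * expR (s ^+ 2 / 2))) => u.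
  have := is_derive_F x u => dF.
  apply: is_derive_eq; rewrite /GRing.scale/=.
  by field.
rewrite expr0n/= mul0r expR0 mulr1 {2}/F.
under eq_Rintegral do rewrite mul0r addr0.
rewrite RintegralZl//; last exact: integrable_normal_pdf.
have -> : \int[mu]_z p z = 1 by rewrite /Rintegral integral_normal_pdf.
rewrite mulr1 => <-; rewrite -/(F x s).
by rewrite -mulrA -expRD subrr expR0 mulr1.
Qed.

End normal.

(** * Convergence in distribution and characteristic functions *)

Section distribution_convergence.
Context (R : realType) (d : measure_display) (T : measurableType d) (P : probability T R).
Context (d' : measure_display) (T' : measurableType d') (P' : probability T' R).
Variables (X : nat -> T -> R) (Y : T' -> R).
Hypotheses (mX : forall n, measurable_fun setT (X n)) (mY : measurable_fun setT Y).

Lemma cvg_in_distributionP : cvg_in_distribution P X P' Y <->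
  forall (f : R -> R) M, continuous f -> (forall x, `|f x| <= M) ->
    \int[P]_w f (X n w) @[n --> \oo] --> \int[P']_w f (Y w).
Proof.
split.
  move=> XY f M cf fM.
  have bf : bounded_fun f.
    by exists M; split=> [|x Mx y _ /=]; rewrite ?num_real// (le_trans (fM y)) ?ltW.
  have := XY f cf bf; have mf := continuous_measurable_fun cf.
  rewrite (expectation_Rintegral P' (M := M) (measurableT_comp mf mY)); last first.
    by move=> w; exact: fM.
  move=> /fine_cvg; apply: cvg_trans; apply: near_eq_cvg; apply: nearW => n /=.
  rewrite (expectation_Rintegral P (M := M) (measurableT_comp mf (mX n)))//.
  by move=> w; exact: fM.
move=> XY f cf [M0 [_ fM0]]; have mf := continuous_measurable_fun cf.
have fM x : `|f x| <= M0 + 1 by apply: fM0; rewrite // ltrDl.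
rewrite (expectation_Rintegral P' (M := M0 + 1) (measurableT_comp mf mY)); last first.
  by move=> w; exact: fM.
rewrite (_ : (fun n => 'E_P[f \o X n])%E = (fun n => (\int[P]_w f (X n w))%:E)); last first.
  apply/funext => n.
  rewrite (expectation_Rintegral P (M := M0 + 1) (measurableT_comp mf (mX n)))//.
  by move=> w; exact: fM.
by apply: cvg_EFin; [exact: nearW|exact: XY fM].
Qed.

End distribution_convergence.

Section uniform.
Context (R : realType).
Implicit Types (h u : R).

(** A bounded continuous majorant of the oscillation of [cos (x + t u)] when [t] moves by at most
    [h]. Being a test function, it can itself be passed to the limit. *)
Let g h u := Num.min 2 (h * `|u|).

Let cg h : continuous (g h).
Proof.
move=> u; apply: (@continuous_min _ _ (fun=> 2) (fun v => h * `|v|) u).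
  exact: cvg_cst.
by apply: cvgMr; exact: norm_continuous.
Qed.

Let g_bnd h u : 0 <= h -> `|g h u| <= 2.
Proof.
move=> h0; rewrite ger0_norm; first by rewrite ge_min lexx.
by rewrite le_min mulr_ge0// ler0n.
Qed.

Let cos_diff d (T : measurableType d) (P : probability T R) (X : T -> R) x s t h :
  measurable_fun setT X -> 0 <= h -> `|t - s| <= h ->
  `|\int[P]_w cos (x + t * X w) - \int[P]_w cos (x + s * X w)| <= \int[P]_w g h (X w).
Proof.
move=> mX h0 tsh.
have i u : P.-integrable setT (EFin \o (fun w => cos (x + u * X w))).
  by apply: integrable_cos; apply: measurable_funD => //; exact: measurable_funM.
have iB := integrable_EFinB measurableT (i t) (i s).
rewrite -RintegralB//; apply: (le_trans (le_normr_Rintegral _ iB)) => //.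
apply: le_Rintegral => //.
- exact: integrable_norm iB.
- apply: (@bounded_integrable _ _ _ _ _ 2) => [|w]; last exact: g_bnd.
  by apply: measurableT_comp mX; exact: continuous_measurable_fun.
- move=> w _; rewrite le_min; apply/andP; split.
    apply: (le_trans (ler_normB _ _)).
    by have := cos_max (x + t * X w); have := cos_max (x + s * X w); lra.
  apply: (le_trans (cos_lipschitz _ _)).
  rewrite (_ : _ - _ = (t - s) * X w); last by ring.
  by rewrite normrM ler_wpM2r.
Qed.

(** Equicontinuity in [t]: the integral of [g h] along [Y] is small for small [h], and along [X n]
    it converges to that value. Convergence at the finitely many points of a grid of mesh [h] then
    extends to all [|t| <= K]. *)
Lemma cvg_in_distribution_cos_unif (d : measure_display) (T : measurableType d)
    (P : probability T R) (d' : measure_display) (T' : measurableType d')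
    (P' : probability T' R) (X : nat -> T -> R) (Y : T' -> R) (x K e : R) :
  (forall n, measurable_fun setT (X n)) -> measurable_fun setT Y ->
  cvg_in_distribution P X P' Y -> 0 < e ->
  \forall n \near \oo, forall t, `|t| <= K ->
    `|\int[P]_w cos (x + t * X n w) - \int[P']_w cos (x + t * Y w)| <= e.
Proof.
move=> mX mY /(cvg_in_distributionP P P' mX mY) XY e0.
have e40 : 0 < e / 4 by rewrite divr_gt0.
have [k Yk] : exists k : nat, \int[P']_w g k.+1%:R^-1 (Y w) < e / 4.
  have : \int[P']_w g n.+1%:R^-1 (Y w) @[n --> \oo] --> \int[P']_w (cst 0 w : R).
    apply: (@bounded_Rintegral_cvg _ _ _ _ _ _ 2).
    - by move=> n; apply: measurableT_comp mY; exact: continuous_measurable_fun.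
    - by move=> n w; exact: g_bnd.
    - move=> w.
      apply: (@squeeze_cvgr _ _ _ _ (fun=> 0) (fun n => `|Y w| * n.+1%:R^-1)).
      + apply: nearW => n; rewrite le_min ler0n mulr_ge0//= ge_min.
        by rewrite mulrC lexx orbT.
      + exact: cvg_cst.
      + by rewrite -[X in _ --> X](mulr0 `|Y w|); apply: cvgMr; exact: cvg_harmonic.
  rewrite (Rintegral_cstT P' 0) => /cvgrPdist_lt/(_ _ e40)[k _ /(_ k (leqnn k))] /=.
  rewrite sub0r normrN => H; exists k.
  exact: le_lt_trans (ler_norm _) H.
set h : R := k.+1%:R^-1 in Yk.
have h0 : 0 < h by rewrite invr_gt0.
have near1 : \forall n \near \oo, \int[P]_w g h (X n w) < e / 4.
  have := XY (g h) 2 (@cg h) (fun u => g_bnd u (ltW h0)).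
  by move=> /cvgr_lt; apply.
(* The grid starts at [- K]; [m] points suffice for the integer part of [(t + K) / h] to be a valid
   index for every [t] in [[- K, K]]. *)
pose m := (Num.trunc (2 * K / h)).+1.
pose t_ (j : nat) := - K + j%:R * h.
have near2 : \forall n \near \oo, forall j : 'I_m,
   `|\int[P]_w cos (x + t_ j * X n w) - \int[P']_w cos (x + t_ j * Y w)| <= e / 4.
  apply: filter_forall => j.
  have := XY (fun u => cos (x + t_ j * u)) 1.
  have cj : continuous (fun u : R => cos (x + t_ j * u)).
    move=> u; apply: continuous_comp; last exact: continuous_cos.
    by apply: cvgD; [exact: cvg_cst|apply: cvgMr; exact: cvg_id].
  move=> /(_ cj (fun u => cos_max _)) /cvgrPdist_le /(_ _ e40).
  by apply: filterS => n; rewrite distrC.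
near=> n => t tK.
have N1 : \int[P]_w g h (X n w) < e / 4 by near: n.
have N2 : forall j : 'I_m,
   `|\int[P]_w cos (x + t_ j * X n w) - \int[P']_w cos (x + t_ j * Y w)| <= e / 4.
  by near: n.
have [tl tu] : - K <= t /\ t <= K by move: tK; rewrite ler_norml => /andP[].
have q0 : 0 <= (t + K) / h by rewrite divr_ge0 ?(ltW h0)//; lra.
have jm : (Num.trunc ((t + K) / h) < m)%N.
  rewrite ltnS; apply: le_truncn; rewrite ler_pM2r ?invr_gt0//; lra.
set j := Ordinal jm.
have tj : `|t - t_ j| <= h.
  have /andP[l1 l2] := truncn_itv q0.
  rewrite /t_ /=; move: l1 l2; rewrite -[_.+1%:R]natr1; set q := _%:R.
  rewrite ler_pdivlMr// ltr_pdivrMr// => l1 l2; rewrite ler_norml; apply/andP; split; nra.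
have := N2 j; have := cos_diff P x (mX n) (ltW h0) tj.
have := cos_diff P' x mY (ltW h0) tj.
set a1 := \int[P']_w cos (x + t * _); set a2 := \int[P']_w cos (x + t_ j * _).
set b1 := \int[P]_w cos (x + t * _); set b2 := \int[P]_w cos (x + t_ j * _).
move=> A1 A2 A3.
rewrite (_ : b1 - a1 = (b1 - b2) + (b2 - a2) - (a1 - a2)); last by ring.
apply: (le_trans (ler_normB _ _)).
have := ler_normD (b1 - b2) (b2 - a2).
have := ltW Yk; have := ltW N1; lra.
Unshelve. all: by end_near. Qed.

End uniform.

(** * From characteristic functions to weak convergence by Gaussian smoothing *)

Section continuity_theorem.
Context (R : realType).
Notation mu := (@lebesgue_measure R).

(** Compactness of the segment in its near-covering form. Only [x] is confined to the segment; [y]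
    may lie outside. *)
Lemma Heine_Cantor_itv (f : R -> R) (a b e : R) : continuous f -> 0 < e ->
  exists2 dl, 0 < dl & forall x y, a <= x <= b -> `|x - y| < dl -> `|f x - f y| < e.
Proof.
move=> cf e0.
have e20 : 0 < e / 2 by rewrite divr_gt0.
have /compact_near_coveringP/(_ _ (0^'+)
  (fun dl x => forall y, `|x - y| < dl -> `|f x - f y| < e)) := @segment_compact R a b.
have H x : `[a, b]%classic x -> \forall x' \near x & dl \near 0^'+,
    forall y, `|x' - y| < dl -> `|f x' - f y| < e.
  move=> _; have /cvgrPdist_lt/(_ _ e20)/nbhs_ballP[r /= r0 rf] := cf x.
  exists (ball x (r / 2), [set dl : R | dl < r / 2]) => /=.
    split; first by apply: nbhsx_ballx; rewrite divr_gt0.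
    by apply: nbhs_right_lt; rewrite divr_gt0.
  move=> [x' dl] /= [xx' dlr] y x'y.
  have h1 : `|f x - f x'| < e / 2.
    by apply: rf; apply: le_ball xx'; rewrite ler_pdivrMr// ler_peMr ?ltW// ltr1n.
  have h2 : `|f x - f y| < e / 2.
    apply: rf; move: xx'; rewrite /ball/= => xx'.
    have := ler_distD x' x y; lra.
  have := ler_distD (f x) (f x') (f y); rewrite (distrC (f x') (f x)); lra.
move=> /(_ _ H) nr.
have : \forall dl \near 0^'+, 0 < dl /\ forall x y : R, a <= x <= b ->
    `|x - y| < dl -> `|f x - f y| < e.
  near=> dl; split; first by near: dl; exact: nbhs_right_gt.
  move=> x y xab; have : `[a, b] `<=` (fun x => forall y, `|x - y| < dl -> `|f x - f y| < e).
    by near: dl; exact: nr.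
  by apply; rewrite /= in_itv.
by move=> /filter_ex[dl [dl0 h]]; exists dl.
Unshelve. all: by end_near. Qed.

(** The convolution of [f] with the centred normal density of standard deviation [s]. *)
Definition gauss_smooth (s : R) (f : R -> R) (x : R) :=
  \int[mu]_y (f y * normal_pdf x s y).

Lemma integrable_mul_normal_pdf (f : R -> R) (M x s : R) : measurable_fun setT f ->
  (forall y, `|f y| <= M) ->
  mu.-integrable setT (EFin \o (fun y => f y * normal_pdf x s y)).
Proof.
move=> mf fM; apply: (le_integrable measurableT _ _
  (integrable_EFinZl measurableT M (integrable_normal_pdf x s))).
  by apply/measurable_EFinP/measurable_funM => //; exact: measurable_normal_pdf.
move=> y _ /=; rewrite lee_fin !normrM (ger0_norm (normal_pdf_ge0 _ _ _)).
by rewrite ler_wpM2r ?normal_pdf_ge0// (le_trans (fM y)) ?ler_norm.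
Qed.

Lemma gauss_smooth_bound (f : R -> R) (M x s : R) : measurable_fun setT f ->
  (forall y, `|f y| <= M) -> `|gauss_smooth s f x| <= M.
Proof.
move=> mf fM; have i := integrable_mul_normal_pdf x s mf fM.
apply: (le_trans (le_normr_Rintegral _ i)) => //.
have -> : M = \int[mu]_y (M * normal_pdf x s y).
  rewrite RintegralZl//; last exact: integrable_normal_pdf.
  by rewrite /Rintegral integral_normal_pdf/= mulr1.
apply: le_Rintegral => //.
- exact: integrable_norm i.
- by apply: integrable_EFinZl => //; exact: integrable_normal_pdf.
- move=> y _; rewrite normrM (ger0_norm (normal_pdf_ge0 _ _ _)).
  by rewrite ler_wpM2r ?normal_pdf_ge0.
Qed.

(** Pointwise [|f y - f x| <= e + 2 M / dl * |y - x|]: the first term suffices when [y] is within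
    [dl] of [x], the second when it is not. Integrating against the density leaves its first
    absolute moment, at most [Num.sqrt 2 * s]. *)
Lemma gauss_smooth_approx (f : R -> R) (M e dl s : R) : measurable_fun setT f ->
  (forall y, `|f y| <= M) -> 0 < dl -> 0 < s ->
  (forall x y, `|x - y| < dl -> `|f x - f y| < e) ->
  forall x, `|gauss_smooth s f x - f x| <= e + 2 * M / dl * (Num.sqrt 2 * s).
Proof.
move=> mf fM dl0 s0 fe x.
have M0 : 0 <= M by exact: le_trans (fM 0).
have e0 : 0 < e by apply: le_lt_trans (fe 0 0 _); rewrite // subrr normr0.
have ip := integrable_normal_pdf x s.
have i := integrable_mul_normal_pdf x s mf fM.
have i2 : mu.-integrable setT (EFin \o (fun y => f x * normal_pdf x s y)).
  by apply: integrable_EFinZl.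
have i3 : mu.-integrable setT (EFin \o (fun y => f y * normal_pdf x s y - f x * normal_pdf x s y)).
  exact: integrable_EFinB.
have i4 : mu.-integrable setT
   (EFin \o (fun y => 2 * M / dl * (`|y - x| * normal_pdf x s y))).
  by apply: integrable_EFinZl => //; exact: integrable_abs_normal_pdf.
have i5 : mu.-integrable setT (EFin \o (fun y => e * normal_pdf x s y)).
  exact: integrable_EFinZl.
have -> : gauss_smooth s f x - f x =
    \int[mu]_y (f y * normal_pdf x s y - f x * normal_pdf x s y).
  rewrite RintegralB// RintegralZl// [X in _ = _ - _ * X]/Rintegral.
  by rewrite integral_normal_pdf/= mulr1.
apply: (le_trans (le_normr_Rintegral _ i3)) => //.
apply: (@le_trans _ _ (\int[mu]_y (e * normal_pdf x s y +
    2 * M / dl * (`|y - x| * normal_pdf x s y)))).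
  apply: le_Rintegral => //.
  - exact: integrable_norm i3.
  - exact: integrable_EFinD.
  - move=> y _; rewrite -mulrBl normrM (ger0_norm (normal_pdf_ge0 _ _ _)).
    rewrite mulrA -mulrDl ler_wpM2r ?normal_pdf_ge0//.
    have [yx|yx] := ltP `|y - x| dl.
      rewrite (le_trans (ltW (fe _ _ yx)))// lerDl mulr_ge0// divr_ge0 ?mulr_ge0//.
      exact: ltW.
    apply: (@le_trans _ _ (2 * M)).
      by have := ler_normB (f y) (f x); have := fM x; have := fM y; lra.
    rewrite -[leLHS]add0r lerD ?(ltW e0)// mulrAC ler_pdivlMr//.
    by rewrite ler_wpM2l ?mulr_ge0.
rewrite RintegralD// !RintegralZl//; last exact: integrable_abs_normal_pdf.
rewrite [X in e * X]/Rintegral integral_normal_pdf/= mulr1 lerD2l.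
by rewrite ler_wpM2l ?Rintegral_abs_normal_pdf// divr_ge0 ?mulr_ge0// (ltW dl0).
Qed.

Section transfer.
Context (d : measure_display) (T : measurableType d) (P : probability T R).
Variable X : T -> R.
Hypothesis mX : measurable_fun setT X.

Let measurable_pdf2 s : s != 0 ->
  measurable_fun setT (fun z : T * R => normal_pdf (X z.1) s z.2).
Proof.
move=> s0; under eq_fun do rewrite normal_pdfE// /normal_fun.
apply: measurable_funM => //; apply: measurableT_comp => //.
apply: measurable_funM => //; apply: measurableT_comp => //.
apply: measurable_funX; apply: measurable_funB => //.
exact: measurableT_comp.
Qed.

Lemma measurable_normal_pdf_comp s y : s != 0 ->
  measurable_fun setT (fun w => normal_pdf (X w) s y).
Proof.
move=> s0; under eq_fun do rewrite normal_pdfE// /normal_fun.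
apply: measurable_funM => //; apply: measurableT_comp => //.
apply: measurable_funM => //; apply: measurableT_comp => //.
by apply: measurable_funX; exact: measurable_funB.
Qed.

Section integrand.
Variables (f : R -> R) (M s : R).
Hypotheses (s0 : s != 0) (mf : measurable_fun setT f) (fM : forall y, `|f y| <= M).

Let F (z : T * R) := f z.2 * normal_pdf (X z.1) s z.2.

Let iF : (P \x mu)%E.-integrable setT (EFin \o F).
Proof.
have M0 : 0 <= M by exact: le_trans (fM 0).
have mF : measurable_fun setT F.
  apply: measurable_funM; first by apply: measurableT_comp.
  exact: measurable_pdf2.
(* Tonelli's criterion: the density has mass 1, so the inner integral of the absolute value is at
   most [M], and [P] is a probability. *)
apply/integrable12ltyP; first exact/measurable_EFinP.
apply: (@le_lt_trans _ _ (\int[P]_x M%:E)%E); last first.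
  by rewrite integral_cst// [X in (_ * X)%E]probability_setT mule1 ltry.
apply: ge0_le_integral => //.
- by move=> w _; apply: integral_ge0.
- apply: (@measurable_fun_fubini_tonelli_F _ _ _ _ _ mu (abse \o (EFin \o F))) => //=.
  by apply: measurableT_comp => //; exact/measurable_EFinP.
- move=> w _ /=.
  have -> : M%:E = (\int[mu]_y (M%:E * (normal_pdf (X w) s y)%:E))%E.
    rewrite integralZl//; last exact: integrable_normal_pdf.
    by rewrite integral_normal_pdf mule1.
  apply: ge0_le_integral => //.
  + exact: (measurable_int mu (integrable_abse (integrable_mul_normal_pdf (X w) s mf fM))).
  + exact: (measurable_int mu (integrable_EFinZl measurableT M (integrable_normal_pdf (X w) s))).
  + move=> y _; rewrite lee_fin normrM (ger0_norm (normal_pdf_ge0 _ _ _)).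
    by rewrite ler_wpM2r ?normal_pdf_ge0.
Qed.

Let fin_smooth w : (\int[mu]_y (EFin \o F) (w, y))%E \is a fin_num.
Proof.
exact: (integrable_fin_num measurableT (integrable_mul_normal_pdf (X w) s mf fM)).
Qed.

Lemma measurable_gauss_smooth : measurable_fun setT (fun w => gauss_smooth s f (X w)).
Proof.
apply/measurable_EFinP; apply: eq_measurable_fun (measurable_fubini_F iF) => w _.
by rewrite /fubini_F/= /gauss_smooth /Rintegral fineK//; exact: fin_smooth.
Qed.

Lemma Rintegral_gauss_smooth :
  \int[P]_w gauss_smooth s f (X w) =
  \int[mu]_y (f y * \int[P]_w normal_pdf (X w) s y).
Proof.
rewrite /Rintegral; congr fine.
transitivity (\int[P]_w \int[mu]_y (EFin \o F) (w, y))%E.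
  apply: eq_integral => w _; rewrite /gauss_smooth /Rintegral fineK//.
  exact: fin_smooth.
rewrite (@Fubini _ _ _ _ _ P mu (EFin \o F) iF); apply: eq_integral => y _.
have my := measurable_normal_pdf_comp y s0.
have iy : P.-integrable setT (EFin \o (fun w => normal_pdf (X w) s y)).
  apply: (bounded_integrable P my (M := normal_peak s)) => w.
  by rewrite ger0_norm ?normal_pdf_ge0// normal_pdf_ub.
rewrite -RintegralZl// /Rintegral fineK//.
exact: (integrable_fin_num measurableT (integrable_EFinZl measurableT (f y) iy)).
Qed.

End integrand.

Lemma measurable_Rintegral_normal_pdf s : s != 0 ->
  measurable_fun setT (fun y => \int[P]_w normal_pdf (X w) s y).
Proof.
move=> s0.
(* [normal_prob 0 1] is here just some probability on the line with which to form a product; the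
   function [y] is sent to does not depend on it. *)
apply: (measurable_bounded_Rintegral P (normal_prob 0 1) (measurable_pdf2 s0)
  (M := normal_peak s)) => z.
by rewrite ger0_norm ?normal_pdf_ge0// normal_pdf_ub.
Qed.

Let mcos2 (y s : R) :
  measurable_fun setT (fun u : T * R => cos (u.2 * y / s + - u.2 / s * X u.1)).
Proof.
apply: measurable_cos_comp; apply: measurable_funD; first by do 2 apply: measurable_funM => //.
apply: measurable_funM => //; last by apply: measurableT_comp.
by apply: measurable_funM => //; apply: measurableT_comp.
Qed.

Lemma measurable_Rintegral_cos (y s : R) :
  measurable_fun setT (fun z : R => \int[P]_w cos (z * y / s + - z / s * X w)).
Proof.
apply: (measurable_bounded_Rintegral P (normal_prob 0 1) (mcos2 y s) (M := 1)).
by move=> u; exact: cos_max.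
Qed.

(* The Gaussian density is, up to normalization, its own Fourier transform,
   so its expectation along X only involves the characteristic function of X. *)
Lemma Rintegral_normal_pdf_cf (y s : R) : s != 0 ->
  \int[P]_w normal_pdf (X w) s y =
  normal_peak s * \int[normal_prob 0 1]_z \int[P]_w cos (z * y / s + - z / s * X w).
Proof.
move=> s0; have E w : normal_pdf (X w) s y = normal_peak s *
    \int[normal_prob 0 1]_z cos (z * y / s + - z / s * X w).
  rewrite normal_pdfE// /normal_fun; congr (_ * _).
  (* Read as a function of [z], the argument has frequency [(y - X w) / s], at which [normal_cf]
     returns the Gaussian exponential of the density. *)
  rewrite (_ : (fun z => _) = (fun z => cos (0 + (y - X w) / s * z))); last first.
    by apply/funext => z; congr cos; field.
  by rewrite normal_cf cos0 mul1r; congr expR; field.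
rewrite -(bounded_Fubini P (normal_prob 0 1) (mcos2 y s) (fun u => cos_max _)).
rewrite -RintegralZl//; first by apply: eq_Rintegral => w _; exact: E.
rewrite (_ : EFin \o _ = EFin \o
    (fun w => (normal_peak s)^-1 * normal_pdf (X w) s y)); last first.
  by apply/funext => w; rewrite /= E mulKf// gt_eqF// normal_peak_gt0.
apply: integrable_EFinZl => //.
have my := measurable_normal_pdf_comp y s0.
apply: (bounded_integrable P my (M := normal_peak s)) => w.
by rewrite ger0_norm ?normal_pdf_ge0// normal_pdf_ub.
Qed.

End transfer.

Section convergence.
Context (d : measure_display) (T : measurableType d) (P : probability T R).
Context (d' : measure_display) (T' : measurableType d') (P' : probability T' R).
Variables (X : nat -> T -> R) (Y : T' -> R).
Hypotheses (mX : forall n, measurable_fun setT (X n)) (mY : measurable_fun setT Y).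
Hypothesis cfXY : forall x t : R,
  \int[P]_w cos (x + t * X n w) @[n --> \oo] --> \int[P']_w cos (x + t * Y w).

(** The Fourier representation turns this into an integral of characteristic functions over [z],
    where dominated convergence with bound 1 applies. *)
Let cvg_normal_pdf (s y : R) : s != 0 ->
  \int[P]_w normal_pdf (X n w) s y @[n --> \oo] --> \int[P']_w normal_pdf (Y w) s y.
Proof.
move=> s0; rewrite Rintegral_normal_pdf_cf//.
under eq_fun do rewrite Rintegral_normal_pdf_cf//.
apply: cvgMr; apply: (@bounded_Rintegral_cvg _ _ _ _ _ _ 1) => [n|n z|z].
- exact: measurable_Rintegral_cos.
- apply: Rintegral_cos_max; apply: measurable_funD => //.
  exact: measurable_funM.
- exact: cfXY.
Qed.

Let pdf_bound (d0 : measure_display) (T0 : measurableType d0) (P0 : probability T0 R)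
    (Z : T0 -> R) s y : measurable_fun setT Z -> s != 0 ->
  `|\int[P0]_w normal_pdf (Z w) s y| <= normal_peak s.
Proof.
move=> mZ s0; apply: le_bounded_Rintegral.
  exact: measurable_normal_pdf_comp.
by move=> w; rewrite ger0_norm ?normal_pdf_ge0// normal_pdf_ub.
Qed.

(** After exchanging the integrals, the densities averaged along [X n] converge for each [y] and are
    bounded by [normal_peak s]. Compact support makes [f] Lebesgue integrable, which provides the
    dominating function. *)
Let cvg_gauss_smooth (f : R -> R) (M k s : R) : s != 0 -> continuous f ->
  (forall y, `|f y| <= M) -> (forall y, k < `|y| -> f y = 0) ->
  \int[P]_w gauss_smooth s f (X n w) @[n --> \oo] --> \int[P']_w gauss_smooth s f (Y w).
Proof.
move=> s0 cf fM fk; have mf := continuous_measurable_fun cf.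
rewrite (Rintegral_gauss_smooth P' mY s0 mf fM).
under eq_fun do rewrite (Rintegral_gauss_smooth P (mX _) s0 mf fM).
have i1 : mu.-integrable setT (EFin \o (fun y => M * \1_(`[-k, k]%classic) y)).
  exact: (integrable_EFinZl measurableT M (integrable_indic_itv (- k) k true false)).
have i_f : mu.-integrable setT (EFin \o f).
  apply: (le_integrable measurableT _ _ i1); first exact/measurable_EFinP.
  move=> y _ /=; rewrite lee_fin.
  have [yk|yk] := leP `|y| k.
    rewrite indicE mem_set ?mulr1; first exact: le_trans (fM y) (ler_norm _).
    by rewrite /= in_itv/= -ler_norml.
  by rewrite fk// normr0.
have idom : mu.-integrable setT (EFin \o (fun y => normal_peak s * `|f y|)).
  by apply: integrable_EFinZl => //; exact: integrable_norm i_f.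
have dom (Z : R -> R) y : `|Z y| <= normal_peak s -> `|f y * Z y| <= normal_peak s * `|f y|.
  by move=> Zs; rewrite normrM mulrC ler_wpM2r.
apply: fine_cvg; rewrite fineK; last first.
  apply: integrable_fin_num => //; apply: (le_integrable measurableT _ _ idom).
    apply/measurable_EFinP/measurable_funM => //.
    exact: measurable_Rintegral_normal_pdf.
  move=> y _; rewrite lee_fin; apply: le_trans (ler_norm _).
  by apply: (dom (fun y => \int[P']_w normal_pdf (Y w) s y)); exact: pdf_bound.
apply: (@dominated_cvg _ _ _ mu _ _ _ _ (EFin \o (fun y => normal_peak s * `|f y|))) => //.
- move=> n; apply/measurable_EFinP/measurable_funM => //.
  exact: measurable_Rintegral_normal_pdf.
- move=> y _; apply: cvg_EFin; first exact: nearW.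
  by apply: cvgMr; exact: cvg_normal_pdf.
- move=> n y _; rewrite lee_fin.
  by apply: (dom (fun y => \int[P]_w normal_pdf (X n w) s y)); exact: pdf_bound.
Qed.

Let Rintegral_dist (d0 : measure_display) (T0 : measurableType d0) (P0 : probability T0 R)
    (f g : T0 -> R) (M e : R) : measurable_fun setT f -> measurable_fun setT g ->
  (forall w, `|f w| <= M) -> (forall w, `|g w| <= M) ->
  (forall w, `|f w - g w| <= e) ->
  `|\int[P0]_w f w - \int[P0]_w g w| <= e.
Proof.
move=> mf mg fM gM fg.
have i_f := bounded_integrable P0 mf fM; have i_g := bounded_integrable P0 mg gM.
rewrite -RintegralB//; apply: le_bounded_Rintegral => //.
exact: measurable_funB.
Qed.

Let cvg_compact_support (f : R -> R) (M k : R) : continuous f ->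
  (forall y, `|f y| <= M) -> (forall y, k < `|y| -> f y = 0) ->
  \int[P]_w f (X n w) @[n --> \oo] --> \int[P']_w f (Y w).
Proof.
move=> cf fM fk; have mf := continuous_measurable_fun cf.
have M0 : 0 <= M by exact: le_trans (fM 0).
apply/cvgrPdist_le => e e0.
have e60 : 0 < e / 6 by rewrite divr_gt0.
(* The support is enlarged by 1 because [dl] will be at most 1: if [|x| > k + 1], every [y] within
   [dl] of [x] is outside the support too, and both values are 0. *)
have [dl0 dl0_gt0 fdl0] := Heine_Cantor_itv (- (k + 1)) (k + 1) cf e60.
pose dl := Num.min dl0 1.
have dl_gt0 : 0 < dl by rewrite lt_min dl0_gt0 ltr01.
have fdl x y : `|x - y| < dl -> `|f x - f y| < e / 6.
  rewrite lt_min => /andP[xy0 xy1].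
  have [xk|xk] := leP `|x| (k + 1).
    by apply: fdl0 => //; rewrite -ler_norml.
  rewrite (fk x) ?(fk y) ?subrr ?normr0//; last by lra.
  by have := ler_distD 0 x y; have := lerB_dist x y; lra.
(* This [s] makes the moment term of [gauss_smooth_approx] at most [e / 6]; the summand 1 keeps the
   denominator positive when [M = 0]. *)
pose s := e / 6 / (2 * M / dl * Num.sqrt 2 + 1).
have q0 : 0 < 2 * M / dl * Num.sqrt 2 + 1.
  by rewrite ltr_wpDl// mulr_ge0// divr_ge0 ?mulr_ge0// ltW.
have s0 : 0 < s by rewrite divr_gt0.
have app x : `|gauss_smooth s f x - f x| <= e / 3.
  apply: (le_trans (gauss_smooth_approx mf fM dl_gt0 s0 fdl x)).
  have : 2 * M / dl * (Num.sqrt 2 * s) <= e / 6.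
    rewrite mulrA /s mulrA ler_pdivrMr// mulrC ler_wpM2l ?ltW//.
    by rewrite ltrDl.
  lra.
have sn0 : s != 0 by rewrite gt_eqF.
have := cvg_gauss_smooth sn0 cf fM fk => /cvgrPdist_le.
have e30 : 0 < e / 3 by rewrite divr_gt0.
move=> /(_ _ e30); apply: filterS => n.
have gsM x := gauss_smooth_bound x s mf fM.
have h1 : `|\int[P]_w gauss_smooth s f (X n w) - \int[P]_w f (X n w)| <= e / 3.
  apply: (Rintegral_dist P (M := M)) => // [|]; last exact: measurableT_comp.
  exact: (measurable_gauss_smooth P (mX n) sn0 mf fM).
have h2 : `|\int[P']_w gauss_smooth s f (Y w) - \int[P']_w f (Y w)| <= e / 3.
  apply: (Rintegral_dist P' (M := M)) => // [|]; last exact: measurableT_comp.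
  exact: (measurable_gauss_smooth P' mY sn0 mf fM).
set a1 := \int[P]_w f _ in h1 *; set a2 := \int[P]_w gauss_smooth _ _ _ in h1 *.
set b1 := \int[P']_w f _ in h2 *; set b2 := \int[P']_w gauss_smooth _ _ _ in h2 *.
move=> h3; rewrite (_ : b1 - a1 = (b2 - a2) + (a2 - a1) - (b2 - b1)); last by ring.
apply: (le_trans (ler_normB _ _)).
have := ler_normD (b2 - a2) (a2 - a1); lra.
Qed.

(** The cutoff [chi k] is 1 on [[-k, k]] and 0 beyond [k + 1], so the compact support case covers
    [chi k] and [f * chi k]. For large [k] the expectation of [chi k] along [Y] is close to 1, hence
    also along [X n] for large [n], and the part of [f] cut off is negligible on both sides. *)
Lemma cvg_in_distribution_cf : cvg_in_distribution P X P' Y.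
Proof.
apply/(cvg_in_distributionP P P' mX mY) => f M cf fM.
have mf := continuous_measurable_fun cf.
have M0 : 0 <= M by exact: le_trans (fM 0).
pose chi (k : nat) (x : R) : R := Num.max 0 (Num.min 1 (k%:R + 1 - `|x|)).
have cchi k : continuous (chi k).
  move=> x; apply: (@continuous_max _ _ (fun=> 0) (fun x => Num.min 1 (k%:R + 1 - `|x|)) x).
    exact: cvg_cst.
  apply: (@continuous_min _ _ (fun=> 1) (fun x => (k%:R + 1 - `|x|)) x).
    exact: cvg_cst.
  by apply: cvgB; [exact: cvg_cst|exact: norm_continuous].
have mchi k := continuous_measurable_fun (cchi k).
have chi0 k x : 0 <= chi k x by rewrite le_max lexx.
have chi1 k x : chi k x <= 1 by rewrite ge_max ler01 ge_min lexx.
have chiN k x : `|chi k x| <= 1 by rewrite ger0_norm.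
have chik k x : k%:R + 1 < `|x| -> chi k x = 0.
  by move=> kx; apply/max_idPl; rewrite ge_min; apply/orP; right; lra.
apply/cvgrPdist_le => e e0.
(* The errors will be [M * e1] for the tail of [Y], [2 * M * e1] for the tail of [X n] and [e1] for
   the truncated integrals. *)
pose e1 := e / (3 * M + 3).
have M30 : 0 < 3 * M + 3 by lra.
have e10 : 0 < e1 by rewrite divr_gt0.
have [k Yk] : exists k : nat, 1 - \int[P']_w chi k (Y w) < e1.
  have : \int[P']_w chi n (Y w) @[n --> \oo] --> \int[P']_w (cst 1 w : R).
    apply: (@bounded_Rintegral_cvg _ _ _ _ _ _ 1) => [n|n w|w] //.
      exact: measurableT_comp.
    apply: cvg_near_cst; near=> n.
    rewrite /chi.
    have Yn : `|Y w| <= n%:R by near: n; exact: nbhs_infty_ger.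
    by rewrite (_ : Num.min _ _ = 1) ?max_r//; apply/min_idPl; lra.
  rewrite (Rintegral_cstT P' 1) => /cvgrPdist_lt/(_ _ e10)[k _ /(_ k (leqnn k))] /=.
  by move=> H; exists k; exact: le_lt_trans (ler_norm _) H.
have XYchi : \int[P]_w chi k (X n w) @[n --> \oo] --> \int[P']_w chi k (Y w).
  exact: (cvg_compact_support (cchi k) (chiN k) (chik k)).
have XYf : \int[P]_w (f (X n w) * chi k (X n w)) @[n --> \oo] -->
    \int[P']_w (f (Y w) * chi k (Y w)).
  apply: (cvg_compact_support (f := fun x => f x * chi k x) (M := M) (k := k%:R + 1)).
  - by move=> x; apply: cvgM; [exact: cf|exact: cchi].
  - move=> x; rewrite normrM -[leRHS]mulr1.
    by apply: ler_pM.
  - by move=> x kx; rewrite chik// mulr0.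
have tail (d0 : measure_display) (T0 : measurableType d0) (P0 : probability T0 R)
    (Z : T0 -> R) : measurable_fun setT Z ->
   `|\int[P0]_w f (Z w) - \int[P0]_w (f (Z w) * chi k (Z w))| <=
   M * (1 - \int[P0]_w chi k (Z w)).
  move=> mZ.
  have mfZ : measurable_fun setT (fun w => f (Z w)) by exact: measurableT_comp.
  have mcZ : measurable_fun setT (fun w => chi k (Z w)).
    by apply: measurableT_comp (mchi k) mZ.
  have ifZ := bounded_integrable P0 mfZ (fun w => fM (Z w)).
  have icZ := bounded_integrable P0 mcZ (fun w => chiN k (Z w)).
  have ifcZ : P0.-integrable setT (EFin \o (fun w => f (Z w) * chi k (Z w))).
    apply: (bounded_integrable P0 (M := M)); first exact: measurable_funM.
    by move=> w; rewrite normrM -[leRHS]mulr1; apply: ler_pM.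
  have i1 : P0.-integrable setT (EFin \o (fun w => (cst 1 w : R))).
    exact: (bounded_integrable P0 (M := `|1|)).
  have iB := integrable_EFinB measurableT ifZ ifcZ.
  rewrite -(Rintegral_cstT P0 1) -RintegralB// -RintegralB//.
  rewrite -RintegralZl//; last exact: integrable_EFinB.
  apply: (le_trans (le_normr_Rintegral _ iB)) => //.
  apply: le_Rintegral => //.
  - exact: integrable_norm iB.
  - by apply: integrable_EFinZl => //; exact: integrable_EFinB.
  - move=> w _; rewrite -{1}[f (Z w)]mulr1 -mulrBr normrM.
    by rewrite (@ger0_norm _ (1 - _)) ?subr_ge0// ler_wpM2r ?subr_ge0.
move/cvgrPdist_le : XYchi => /(_ _ e10) n1.
move/cvgrPdist_le : XYf => /(_ _ e10) n2.
near=> n.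
have N1 : `|\int[P']_w chi k (Y w) - \int[P]_w chi k (X n w)| <= e1 by near: n.
have N2 : `|\int[P']_w (f (Y w) * chi k (Y w)) - \int[P]_w (f (X n w) * chi k (X n w))| <= e1.
  by near: n.
have := tail _ _ P (X n) (mX n); have := tail _ _ P' Y mY.
move: N1 N2 Yk; set c := \int[P']_w chi k _; set c' := \int[P]_w chi k _.
set g := \int[P']_w (_ * _); set g' := \int[P]_w (_ * _).
set h := \int[P']_w f _; set h' := \int[P]_w f _.
move=> cc gg ck hg hg'.
have c'k : 1 - c' <= 2 * e1 by move: cc; rewrite ler_norml => /andP[]; lra.
have t1 : M * (1 - c) <= M * e1 by rewrite ler_wpM2l// ltW.
have t2 : M * (1 - c') <= M * (2 * e1) by rewrite ler_wpM2l.
have eE : e = 3 * M * e1 + 3 * e1.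
  by rewrite -mulrDl mulrC /e1 divfK// gt_eqF.
rewrite (_ : h - h' = (h - g) + (g - g') - (h' - g')); last by ring.
apply: (le_trans (ler_normB _ _)).
have := ler_normD (h - g) (g - g'); lra.
Unshelve. all: by end_near. Qed.

End convergence.
End continuity_theorem.

(** * Characteristic functions in the domain of attraction of the normal law *)

Section deterministic.
Context (R : realType).

(** In the right half-plane [atan (B / A)] is an argument, and its size is controlled because [atan]
    is 1-Lipschitz at 0. *)
Lemma polar_coordinates (A B : R) : 0 < A ->
  exists r al, [/\ 0 < r, A = r * cos al, B = r * sin al & `|al| <= `|B| / A].
Proof.
move=> A0; set al := atan (B / A).
have c0 : 0 < cos al.
  by rewrite cos_atan invr_gt0 sqrtr_gt0 ltr_pwDl// sqr_ge0.
exists (A / cos al), al; split.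
- exact: divr_gt0.
- by rewrite divfK// gt_eqF.
- have : tan al = B / A by exact: atanK.
  rewrite /tan => tE.
  by rewrite mulrAC -mulrA tE mulrC divfK// gt_eqF.
- by apply: (le_trans (atan_le_norm _)); rewrite normrM normfV (gtr0_norm A0).
Qed.

Lemma le_sin01 (x y : R) : 0 <= x -> x <= y -> y <= 1 -> sin x <= sin y.
Proof.
move=> x0; have pi1 := @pihalf_ge1 R; rewrite le_eqVlt => /predU1P[<-//|xy] y1.
by apply: ltW; rewrite ltr_sin// in_itv/=; apply/andP; split; lra.
Qed.

Lemma cf_real_part (n K1 e A B s : R) : 0 < e <= 1 -> 1 <= n ->
  4 * (K1 + 1) ^+ 2 / e <= n -> 1 / 2 < A <= 1 -> n * `|B| < e / 2 ->
  0 <= s -> s + 1 <= K1 -> `|n * (1 - (A ^+ 2 + B ^+ 2)) - s| <= e / 4 ->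
  `|n * (1 - A) - s / 2| <= e.
Proof.
move=> /andP[e0 e1] n1 n3 /andP[A12 A1] nB s0 sK.
have n0 : 0 < n by exact: lt_le_trans n1.
have B2 : n * B ^+ 2 <= e / 4.
  rewrite -(real_normK (num_real B)) expr2 mulrA.
  have B12 : `|B| <= 1 / 2.
    have : `|B| <= n * `|B| by rewrite ler_peMl.
    by clear - nB e1; lra.
  have : n * `|B| * `|B| <= e / 2 * `|B| by rewrite ler_wpM2r// ltW.
  clear - B12 e0; nra.
have B20 : 0 <= n * B ^+ 2 by rewrite mulr_ge0 ?sqr_ge0 ?(ltW n0).
set u := n * (1 - A); set p := n * (1 - (A ^+ 2 + B ^+ 2)).
have u0 : 0 <= u by rewrite mulr_ge0 ?subr_ge0 ?(ltW n0).
have uA : u * (1 + A) = p + n * B ^+ 2 by rewrite /u /p; ring.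
have uu : u * (1 + A) = 2 * u - u ^+ 2 / n by rewrite /u; field; rewrite gt_eqF.
move: uA uu B2 B20 u0; move: (n * B ^+ 2) => v; move: p => p uA uu v1 v0 u0 ps.
have [ps1 ps2] : - (e / 4) <= p - s /\ p - s <= e / 4.
  by move: ps; rewrite ler_norml => /andP[].
have uK : u <= K1 + 1.
  have : u * (1 + A) <= K1 + 1 by rewrite uA; clear - ps2 v1 sK e1 e0; lra.
  by apply: le_trans; rewrite ler_peMr//; clear - A12; lra.
have un : u ^+ 2 / n <= e / 4.
  rewrite ler_pdivrMr//.
  have : u ^+ 2 <= (K1 + 1) ^+ 2 by rewrite ler_sqr ?nnegrE// ?(le_trans _ uK).
  by move: n3; rewrite ler_pdivrMr//; clear; lra.
have un0 : 0 <= u ^+ 2 / n by rewrite divr_ge0 ?sqr_ge0 ?ltW.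
move: un un0 uu; move: (u ^+ 2 / n) => q un un0; rewrite uA => uu.
rewrite ler_norml; apply/andP; clear - ps1 ps2 v0 v1 un un0 uu e0; split; lra.
Qed.

(** Here [q] is a squared modulus whose [n]-th power is close to [expR (- t ^ 2)]. Taking
    logarithms, [L = n ln q] is close to [- t ^ 2], and [n (1 - q)] differs from [- L] by a
    quadratic term of order [1 / n]. *)
Lemma cf_modulus (K e : R) : 0 <= K -> 0 < e <= 1 ->
  exists2 dl, 0 < dl <= 1 & \forall n \near \oo, forall t C D q : R, `|t| <= K ->
    `|C - expR (- (t ^+ 2 / 2))| <= dl -> `|D| <= dl -> 0 <= q ->
    q ^+ n = C ^+ 2 + D ^+ 2 ->
    `|n%:R * (1 - q) - t ^+ 2| <= e /\ expR (- (K ^+ 2)) / 2 <= q ^+ n.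
Proof.
move=> K0 /andP[e0 e1].
set EK := expR (K ^+ 2).
have EK1 : 1 <= EK by rewrite -expR0 ler_expR sqr_ge0.
(* The squared modulus is off by at most [4 * dl]; multiplying by [expR (t ^ 2) <= EK] leaves a
   relative error of [e / 4]. *)
exists (e / (16 * EK)).
  rewrite divr_gt0 ?mulr_gt0 ?(lt_le_trans _ EK1)//=.
  by rewrite ler_pdivrMr ?mulr_gt0 ?(lt_le_trans _ EK1)//; lra.
set dl := e / _.
have EK0 : 0 < EK by exact: lt_le_trans EK1.
have dlE : dl * EK = e / 16 by rewrite /dl; field; rewrite gt_eqF.
have dl0 : 0 < dl by rewrite divr_gt0// mulr_gt0.
have dl1 : dl <= 1 by rewrite ler_pdivrMr ?mulr_gt0//; lra.
set K1 := K ^+ 2 + 1.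
have K10 : 0 < K1 by rewrite ltr_wpDl// sqr_ge0.
near=> n => t C D q tK Ct Dt q0 qn.
have n1 : 2 * K1 <= n%:R by near: n; exact: nbhs_infty_ger.
have n2 : 4 * K1 ^+ 2 / e <= n%:R by near: n; exact: nbhs_infty_ger.
have n0 : 0 < n%:R :> R by lra.
have nn0 : (0 < n)%N by rewrite ltr0n in n0.
have tK2 : t ^+ 2 <= K ^+ 2.
  by rewrite -(real_normK (num_real t)) ler_sqr ?nnegrE.
set ht := expR (- (t ^+ 2 / 2)) in Ct.
have ht1 : ht <= 1 by rewrite -expR0 ler_expR oppr_le0 divr_ge0 ?sqr_ge0.
have ht0 : 0 < ht by exact: expR_gt0.
have htt : ht ^+ 2 * expR (t ^+ 2) = 1.
  by rewrite -expRM_natl -expRD -[RHS]expR0; congr expR; field.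
have Et : expR (t ^+ 2) <= EK by rewrite ler_expR.
set E := expR (t ^+ 2) in htt Et.
have E0 : 0 < E by exact: expR_gt0.
set Q := C ^+ 2 + D ^+ 2 in qn.
have QE : `|Q * E - 1| <= e / 4.
  rewrite -[X in _ - X]htt -mulrBl normrM (gtr0_norm E0).
  have : `|Q - ht ^+ 2| <= 4 * dl.
    move: Ct Dt; rewrite !ler_norml => /andP[a1 a2] /andP[b1 b2].
    by rewrite /Q; apply/andP; split; nra.
  move=> h; apply: (@le_trans _ _ (4 * dl * EK)); last by rewrite -mulrA dlE; lra.
  by apply: ler_pM => //; exact: ltW.
have QE2 : 1 - e / 4 <= Q * E /\ Q * E <= 1 + e / 4.
  by move: QE; rewrite ler_norml => /andP[]; lra.
have QE0 : 0 < Q * E by lra.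
have Q0 : 0 < Q by rewrite pmulr_lgt0 in QE0.
have qp : 0 < q.
  rewrite lt_neqAle q0 andbT eq_sym; apply/eqP => q00.
  by move: Q0; rewrite -qn q00 expr0n (gtn_eqF nn0) ltxx.
set y := ln q.
have qE : q = expR y by rewrite lnK.
set L := n%:R * y.
have LE : expR (L + t ^+ 2) = Q * E.
  by rewrite expRD expRM_natl -qE qn.
have L1 : L + t ^+ 2 <= e / 4.
  by have := expR_ge1Dx (L + t ^+ 2); rewrite LE; lra.
have L2 : - (e / 2) <= L + t ^+ 2.
  have := expR_ge1Dx (- (L + t ^+ 2)); rewrite expRN LE => h.
  have : (Q * E)^-1 <= 1 + e / 2.
    by rewrite -[leLHS]div1r ler_pdivrMr//; nra.
  lra.
have Ln : `|L| <= K1.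
  rewrite ler_norml /K1; have := sqr_ge0 t; lra.
have yn : `|y| <= 1 / 2.
  have nL : n%:R * `|y| = `|L| by rewrite /L normrM (gtr0_norm n0).
  by rewrite -(ler_pM2l n0) nL; apply: (le_trans Ln); lra.
split; last first.
  rewrite qn.
  have EKi : expR (- K ^+ 2) = EK^-1 by rewrite expRN.
  rewrite EKi.
  have : EK^-1 / 2 * E <= Q * E.
    apply: (@le_trans _ _ (1 / 2)); last by lra.
    rewrite mulrAC ler_pM2r// mulrC ler_pdivrMr// mul1r//.
  by rewrite ler_pM2r.
have := expR_quadratic yn; rewrite -qE => hq.
have hq2 : n%:R * `|q - 1 - y| <= e / 2.
  apply: (@le_trans _ _ (n%:R * (2 * y ^+ 2))); first by rewrite ler_wpM2l// ltW.
  have -> : n%:R * (2 * y ^+ 2) = 2 * L ^+ 2 / n%:R.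
    by rewrite /L; field; rewrite gt_eqF.
  rewrite ler_pdivrMr//.
  have : L ^+ 2 <= K1 ^+ 2 by rewrite -(real_normK (num_real L)) ler_sqr ?nnegrE// ltW.
  move: n2; rewrite ler_pdivrMr//; clear; lra.
have -> : n%:R * (1 - q) - t ^+ 2 = - (n%:R * (q - 1 - y)) - (L + t ^+ 2).
  by rewrite /L; ring.
apply: (le_trans (ler_normB _ _)); rewrite normrN normrM (gtr0_norm n0).
have : `|L + t ^+ 2| <= e / 2.
  by rewrite ler_norml; apply/andP; clear - L1 L2 e0; split; lra.
clear - hq2; lra.
Unshelve. all: by end_near. Qed.

(* If the modulus of [A + iB] stays close to 1 and the [n]-th power of this
   continuous path starting at 1 stays close to the positive real axis, then
   the path has no room to reach another [n]-th root of unity. *)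
Lemma cf_phase (n : nat) (A B : R -> R) (K K1 c dl rho : R) :
  continuous A -> continuous B -> A 0 = 1 -> B 0 = 0 ->
  0 < c <= 1 / 2 -> 0 <= K1 -> 2 * K1 < n%:R -> 1 <= n%:R :> R ->
  (forall t, A t ^+ 2 + B t ^+ 2 <= 1) ->
  (forall t, 0 <= t <= K -> n%:R * (1 - (A t ^+ 2 + B t ^+ 2)) <= K1) ->
  (forall t, 0 <= t <= K -> rho <= (A t ^+ 2 + B t ^+ 2) ^+ n) ->
  (forall t r al, 0 <= t <= K -> A t = r * cos al -> B t = r * sin al ->
     `|r ^+ n * sin (n%:R * al)| <= dl) ->
  dl ^+ 2 < rho * sin c ^+ 2 ->
  forall t, 0 <= t <= K -> n%:R * `|B t| < c /\ 1 / 2 < A t.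
Proof.
move=> cA cB A0 B0 /andP[c0 c12] K10 nK1 n1 q1 qK1 qrho qdl dlrho t1 /andP[t10 t1K].
(* [g t < 1] is the conclusion at [t]. If it fails at [t1], then, as [g 0 = 0], the intermediate
   value theorem yields a point [t2] with [g t2 = 1]. *)
pose g t := Num.max (n%:R * `|B t| / c) (2 * (1 - A t)).
have cg : continuous g.
  move=> t; apply: (@continuous_max _ _ (fun t => n%:R * `|B t| / c) (fun t => 2 * (1 - A t)) t).
    apply: cvgMl; apply: cvgMr; apply: cvg_norm; exact: cB.
  by apply: cvgMr; apply: cvgB; [exact: cvg_cst|exact: cA].
have n0 : 0 < n%:R :> R by exact: lt_le_trans n1.
have [g1|g1] := ltP (g t1) 1.
  move: g1; rewrite gt_max ltr_pdivrMr// mul1r => /andP[h1 h2].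
  by split=> //; lra.
exfalso.
have g0 : g 0 = 0 by rewrite /g A0 B0 normr0 mulr0 mul0r subrr mulr0 maxxx.
have [t2 t2t1 gt2] : exists2 t, t \in `[0, t1] & g t = 1.
  apply: IVT => //; first exact: continuous_subspaceT.
  rewrite g0 ge_min ler01/=.
  by rewrite le_max g1 orbT.
have t2K : 0 <= t2 <= K.
  by move: t2t1; rewrite in_itv/= => /andP[-> /= ?]; exact: le_trans t1K.
have Bc : n%:R * `|B t2| <= c.
  have : n%:R * `|B t2| / c <= g t2 by rewrite /g le_max lexx.
  by rewrite gt2 ler_pdivrMr// mul1r.
have A12 : 1 / 2 <= A t2.
  have : 2 * (1 - A t2) <= g t2 by rewrite /g le_max lexx orbT.
  by rewrite gt2; lra.
have B12 : `|B t2| <= 1 / 2.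
  apply: le_trans c12; apply: le_trans Bc; rewrite ler_peMl//.
have qB : `|B t2| ^+ 2 = B t2 ^+ 2 by rewrite real_normK// num_real.
have := q1 t2; have := qK1 _ t2K; have := qrho _ t2K.
rewrite -qB.
set a := A t2 in A12 *; set b := `|B t2| in Bc B12 *.
have b0 : 0 <= b by exact: normr_ge0.
move=> rq nq qq1.
(* The modulus bound excludes [a = 1 / 2], since [b <= 1 / 2] would give [a ^ 2 + b ^ 2 <= 1 / 2].
   So the constraint attained at [t2] is [n * b = c]. *)
have q12 : 1 / 2 < a ^+ 2 + b ^+ 2.
  rewrite -(ltr_pM2l n0); move: nq; rewrite mulrBr; lra.
have a12 : 1 / 2 < a.
  rewrite lt_neqAle A12 andbT; apply/eqP => a12.
  by move: q12; rewrite -a12; nra.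
have nbc : n%:R * b = c.
  move: gt2; rewrite /g -/a -/b /Num.max; case: ifP => _ h; first by lra.
  by rewrite -[LHS](divfK (lt0r_neq0 c0)) h mul1r.
have a0 : 0 < a by lra.
have [r [al [r0 aE BE alb]]] := polar_coordinates (B t2) a0.
have rq2 : r ^+ 2 = a ^+ 2 + b ^+ 2.
  by rewrite qB aE BE !exprMn -mulrDr cos2Dsin2 mulr1.
have r1 : r <= 1 by rewrite -(@expr_le1 _ 2%N) ?(ltW r0)// rq2.
have := qdl _ r al t2K aE BE.
(* At [t2] the angle [n * al] has size between [c] and 1, so its sine is at least [sin c]: the
   [n]-th power is then too far from the real axis for the bound [dl]. *)
have nal1 : n%:R * `|al| <= 1.
  apply: (@le_trans _ _ (n%:R * (b / a))); first by rewrite ler_wpM2l// ltW.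
  rewrite mulrA nbc ler_pdivrMr//; lra.
have nal2 : c <= n%:R * `|al|.
  rewrite -nbc ler_wpM2l ?(ltW n0)//.
  apply: le_trans (sin_le_norm al).
  by rewrite /b BE normrM (gtr0_norm r0) ler_piMl.
have sc : 0 < sin c by apply: sin2_gt0; rewrite c0 /=; clear - c12; lra.
have sal : sin c <= `|sin (n%:R * al)|.
  have sp : 0 < sin (n%:R * `|al|) by apply: sin2_gt0; clear - nal1 nal2 c0; lra.
  have -> : `|sin (n%:R * al)| = sin (n%:R * `|al|).
    have [al0|al0] := leP 0 al; first by move: sp; rewrite ger0_norm// => /gtr0_norm.
    by move: sp; rewrite (ltr0_norm al0) mulrN sinN oppr_gt0 => /ltr0_norm.
  exact: le_sin01 (ltW c0) nal2 nal1.
rewrite normrM (gtr0_norm (exprn_gt0 n r0)) => h.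
have h2 : r ^+ n * sin c <= dl.
  by apply: le_trans h; rewrite ler_wpM2l// exprn_ge0// ltW.
have : (r ^+ n * sin c) ^+ 2 <= dl ^+ 2.
  by rewrite ler_sqr ?nnegrE// ?(le_trans _ h2)// mulr_ge0// ?exprn_ge0 ?ltW.
rewrite exprMn exprAC rq2 => h3.
have : rho * sin c ^+ 2 <= (a ^+ 2 + b ^+ 2) ^+ n * sin c ^+ 2.
  by rewrite ler_wpM2r// sqr_ge0.
by move=> h4; have := le_lt_trans (le_trans h4 h3) dlrho; rewrite ltxx.
Qed.

End deterministic.

Section attraction.
Context (R : realType) (d : measure_display) (T : measurableType d) (P : probability T R).
Variables (xi : nat -> {RV P >-> R}) (a : nat -> R).
Hypothesis xi_iid : iid xi.
Hypothesis clt : cvg_in_distribution P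
  (fun n w => (a n)^-1 * \sum_(k < n) xi k w) (normal_prob 0 1) idfun.

Definition cfRe (s : R) := \int[P]_w cos (s * xi 0%N w).
Definition cfIm (s : R) := \int[P]_w sin (s * xi 0%N w).

Let mxi (s : R) : measurable_fun setT (fun w => s * xi 0%N w).
Proof. exact: measurable_funM. Qed.

Lemma continuous_cfRe : continuous cfRe.
Proof.
move=> s; apply/(@cvg_nbhsP _ R^o) => u us.
apply: (@bounded_Rintegral_cvg _ _ _ _ _ _ 1) => [n|n w|w].
- exact: measurable_cos_comp.
- exact: cos_max.
- apply: continuous_cvg; first exact: continuous_cos.
  exact: cvgMl.
Qed.

Lemma continuous_cfIm : continuous cfIm.
Proof.
move=> s; apply/(@cvg_nbhsP _ R^o) => u us.
apply: (@bounded_Rintegral_cvg _ _ _ _ _ _ 1) => [n|n w|w].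
- exact: measurable_sin_comp.
- exact: sin_max.
- apply: continuous_cvg; first exact: continuous_sin.
  exact: cvgMl.
Qed.

Lemma cfRe_le1 s : cfRe s <= 1.
Proof. by have := Rintegral_cos_max P (mxi s); rewrite -/(cfRe s) ler_norml => /andP[]. Qed.

(** The [n]-th power of the characteristic function at [t / a n] is that of the normalized sum,
    uniformly close to the normal one. [cf_phase] selects the root near 1, which bounds the
    imaginary part; [cf_modulus] and [cf_real_part] then give the real part. *)
Lemma cf_scaled_cvg (K e : R) : 0 < K -> 0 < e ->
  \forall n \near \oo, forall t, `|t| <= K ->
    `|n%:R * (1 - cfRe (t / a n)) - t ^+ 2 / 2| <= e /\
    n%:R * `|cfIm (t / a n)| <= e.
Proof.
wlog e1 : e / e <= 1.
  move=> H K0 e0; have : 0 < Num.min e 1 by rewrite lt_min e0 ltr01.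
  have m1 : Num.min e 1 <= 1 by rewrite ge_min lexx orbT.
  move=> /(H _ m1 K0); apply: filterS => n h t /h.
  by rewrite !le_min => -[/andP[? _] /andP[? _]].
move=> K0 e0.
pose c := e / 2.
have c0 : 0 < c by rewrite divr_gt0.
have c12 : c <= 1 / 2 by rewrite /c; lra.
have ce : c <= e by rewrite /c; lra.
have e41 : e / 4 <= 1 by lra.
have e'1 : 0 < e / 4 <= 1 by lra.
have [dl1 /andP[dl10 dl11] nmod] := cf_modulus (ltW K0) e'1.
pose rho := expR (- (K ^+ 2)) / 2.
have rho0 : 0 < rho by rewrite divr_gt0// expR_gt0.
have sc : 0 < sin c by apply: sin2_gt0; lra.
have rs0 : 0 < rho * sin c ^+ 2 by rewrite mulr_gt0// exprn_gt0.
(* One accuracy for two purposes: [dl1] for the modulus, the other bound for excluding nontrivial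
   roots of unity. *)
pose dl := Num.min dl1 (rho * sin c ^+ 2 / 2).
have dl0 : 0 < dl by rewrite lt_min dl10 divr_gt0.
have dll1 : dl <= dl1 by rewrite ge_min lexx.
have dlrho : dl ^+ 2 < rho * sin c ^+ 2.
  have : dl <= rho * sin c ^+ 2 / 2 by rewrite ge_min lexx orbT.
  by have : dl <= 1 := le_trans dll1 dl11; nra.
have mS n : measurable_fun setT (fun w => (a n)^-1 * \sum_(k < n) xi k w).
  by apply: measurable_funM => //; exact: measurable_sum.
have nC := cvg_in_distribution_cos_unif (P' := normal_prob 0 1) 0 K mS
  (@measurable_id _ _ _) clt dl0.
(* The phase [- (pi / 2)] gives the imaginary part, whose limit is 0; the phase 0 gave the real
   part. *)
have nD := cvg_in_distribution_cos_unif (P' := normal_prob 0 1) (- (pi / 2)) K mS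
  (@measurable_id _ _ _) clt dl0.
pose K1 := K ^+ 2 + 1.
have K10 : 0 < K1 by rewrite ltr_wpDl// sqr_ge0.
near=> n.
have n1 : 1 <= n%:R :> R by near: n; exact: nbhs_infty_ger.
have n2 : 2 * K1 < n%:R by near: n; exact: nbhs_infty_gtr.
have n3 : 4 * (K1 + 1) ^+ 2 / e <= n%:R by near: n; exact: nbhs_infty_ger.
have hmod : forall t C D q : R, `|t| <= K ->
    `|C - expR (- (t ^+ 2 / 2))| <= dl1 -> `|D| <= dl1 -> 0 <= q ->
    q ^+ n = C ^+ 2 + D ^+ 2 ->
    `|n%:R * (1 - q) - t ^+ 2| <= e / 4 /\ rho <= q ^+ n by near: n.
have hC : forall t, `|t| <= K ->
   `|\int[P]_w cos (0 + t * ((a n)^-1 * \sum_(k < n) xi k w)) -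
     \int[normal_prob 0 1]_w cos (0 + t * w)| <= dl by near: n.
have hD : forall t, `|t| <= K ->
   `|\int[P]_w cos (- (pi / 2) + t * ((a n)^-1 * \sum_(k < n) xi k w)) -
     \int[normal_prob 0 1]_w cos (- (pi / 2) + t * w)| <= dl by near: n.
have n0 : 0 < n%:R :> R by exact: lt_le_trans n1.
pose A t := cfRe (t / a n); pose B t := cfIm (t / a n).
have q1 t : A t ^+ 2 + B t ^+ 2 <= 1 by exact: Rintegral_cos2Dsin2_le1.
have nD' t : `|t| <= K -> `|\int[P]_w cos (- (pi / 2) + t / a n * \sum_(k < n) xi k w)| <= dl.
  move=> tK; have := hD _ tK; rewrite normal_cf cosN cos_pihalf mul0r subr0.
  by under eq_Rintegral do rewrite mulrA.
have mod t : `|t| <= K -> `|n%:R * (1 - (A t ^+ 2 + B t ^+ 2)) - t ^+ 2| <= e / 4 /\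
    rho <= (A t ^+ 2 + B t ^+ 2) ^+ n.
  move=> tK; apply: (hmod t (\int[P]_w cos (t / a n * \sum_(k < n) xi k w))
     (\int[P]_w sin (t / a n * \sum_(k < n) xi k w))) => //.
  - have := hC _ tK; rewrite normal_cf cos0 mul1r.
    under eq_Rintegral do rewrite add0r mulrA.
    by move=> h; exact: le_trans h dll1.
  - apply: le_trans dll1; apply: le_trans (nD' t tK).
    by under eq_Rintegral do rewrite -cosBpihalf addrC.
  - by rewrite addr_ge0 ?sqr_ge0.
  - rewrite Rintegral_cos2Dsin2_sum//; first exact: xi_iid.1.
    exact: xi_iid.2.
have pos t : 0 <= t <= K -> `|t| <= K by move=> /andP[t0 tK]; rewrite ger0_norm.
have cA : continuous A.
  move=> t; apply: continuous_cvg; first exact: continuous_cfRe.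
  by apply: cvgMl; exact: cvg_id.
have cB : continuous B.
  move=> t; apply: continuous_cvg; first exact: continuous_cfIm.
  by apply: cvgMl; exact: cvg_id.
have A0 : A 0 = 1.
  rewrite /A /cfRe; under eq_Rintegral do rewrite !mul0r cos0.
  exact: Rintegral_cstT P 1.
have B0 : B 0 = 0.
  rewrite /B /cfIm; under eq_Rintegral do rewrite !mul0r sin0.
  exact: Rintegral_cstT P 0.
have phase : forall t, 0 <= t <= K -> n%:R * `|B t| < c /\ 1 / 2 < A t.
  apply: (@cf_phase _ n A B K K1 c dl rho) => //.
  - by rewrite c0.
  - exact: ltW.
  - move=> t tK; have [+ _] := mod _ (pos _ tK).
    have : t ^+ 2 <= K ^+ 2.
      by case/andP: tK => t0 tK; rewrite ler_sqr ?nnegrE ?(ltW K0).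
    rewrite ler_norml => h /andP[_]; rewrite lerBlDl => h2.
    by apply: (le_trans h2); exact: lerD.
  - by move=> t tK; have [] := mod _ (pos _ tK).
  - move=> t r al tK Ar Br.
    have := nD' _ (pos _ tK).
    rewrite (Rintegral_cos_sum_polar xi_iid.1 xi_iid.2 _ _ Ar Br).
    by rewrite [X in cos X]addrC cosBpihalf.
(* Conjugation symmetry: the real part is even and the imaginary part odd, so nonnegative [t]
   suffice. *)
have AN t : A (- t) = A t.
  by apply: eq_Rintegral => w _; rewrite !mulNr cosN.
have BN t : `|B (- t)| = `|B t|.
  rewrite -[RHS]normrN; congr `|_|; rewrite /B /cfIm -[RHS]mulN1r -RintegralZl//.
    by apply: eq_Rintegral => w _; rewrite [RHS]mulN1r !mulNr sinN.
  exact: integrable_sin.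
have res t : 0 <= t <= K -> `|n%:R * (1 - A t) - t ^+ 2 / 2| <= e /\ n%:R * `|B t| <= e.
  move=> tK; have [Bt At] := phase _ tK; have [mt _] := mod _ (pos _ tK).
  split; last exact: (le_trans (ltW Bt) ce).
  have t2 : t ^+ 2 <= K ^+ 2.
    by case/andP: tK => t0 tK; rewrite ler_sqr ?nnegrE ?(ltW K0).
  apply: (cf_real_part (K1 := K1) (B := B t)) => //.
  - by rewrite e0.
  - by rewrite At; exact: cfRe_le1.
  - exact: sqr_ge0.
  - by rewrite lerD2r.
move=> t tK; have [t0|t0] := leP 0 t.
  by apply: res; rewrite t0/=; move: tK; rewrite ger0_norm.
have : 0 <= - t <= K by move: tK; rewrite ltr0_norm// => ->; rewrite oppr_ge0 ltW.
by move=> /res; rewrite AN BN sqrrN.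
Unshelve. all: by end_near. Qed.

End attraction.

(** * Sums with deterministic weights *)

Section weighted_sums.
Context (R : realType) (d : measure_display) (T : measurableType d) (P : probability T R).
Variables (xi : nat -> {RV P >-> R}) (a : nat -> R).
Hypothesis xi_iid : iid xi.
Hypothesis clt : cvg_in_distribution P
  (fun n w => (a n)^-1 * \sum_(k < n) xi k w) (normal_prob 0 1) idfun.

(* The doubling inequalities transport the bound for arguments of order [1/a n]
   to all larger ones; this replaces the slow variation of the truncated second
   moment of [xi]. *)
Lemma cf_growth (t : R) : \forall n \near \oo, forall w, 1 <= `|w| ->
  n%:R * (1 - cfRe xi (t * w / a n)) <= (2 * t ^+ 2 + 4) * w ^+ 2 /\
  n%:R * `|cfIm xi (t * w / a n)| <= (2 * t ^+ 2 + 8) * w ^+ 2.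
Proof.
have K0 : 0 < `|t| + 1 by rewrite ltr_wpDl.
have := cf_scaled_cvg xi_iid clt K0 ltr01; apply: filterS => n H w w1.
have [k [k1 k2]] := exists_pow2_between w1.
have p0 : 0 < 2 ^+ k :> R by rewrite exprn_gt0.
(* Dividing by a power of 2 comparable to [|w|] brings the argument back to [|s| <= |t|], where
   [cf_scaled_cvg] applies with error 1. Undoing the [k] halvings costs [4 ^ k <= 4 * w ^ 2]. *)
pose s := t * w / 2 ^+ k.
have st : `|s| <= `|t|.
  by rewrite /s !normrM normfV (gtr0_norm p0) ler_pdivrMr// ler_wpM2l.
have sK : `|s| <= `|t| + 1 by apply: (le_trans st); rewrite lerDl.
have [s1 s2] := H s sK.
have s3 : n%:R * (1 - cfRe xi (s / a n)) <= t ^+ 2 / 2 + 1.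
  move: s1; rewrite ler_norml => /andP[_].
  have : s ^+ 2 <= t ^+ 2.
    by rewrite -(real_normK (num_real s)) -(real_normK (num_real t)) ler_sqr ?nnegrE.
  lra.
have mX : measurable_fun setT (fun w => s / a n * xi 0%N w) by exact: measurable_funM.
have E : t * w / a n = 2 ^+ k * (s / a n).
  by rewrite mulrA; congr (_ / _); rewrite /s [RHS]mulrC divfK// gt_eqF.
have p4 : 4 ^+ k = (2 ^+ k) ^+ 2 :> R by rewrite exprAC; congr (_ ^+ _); ring.
have p4w : 4 ^+ k <= 4 * w ^+ 2 :> R.
  rewrite p4 (_ : 4 * w ^+ 2 = (2 * `|w|) ^+ 2); last first.
    by rewrite exprMn real_normK ?num_real//; ring.
  by rewrite ler_sqr ?nnegrE ?(ltW p0)// mulr_ge0.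
have p24 : 2 ^+ k <= 4 * w ^+ 2 :> R.
  apply: (le_trans _ p4w); rewrite p4 expr2 ler_peMl ?(ltW p0)//.
  exact: le_trans k1.
have n0 : 0 <= n%:R :> R by [].
have u0 : 0 <= 1 - cfRe xi (s / a n) by rewrite subr_ge0 cfRe_le1.
have nu0 : 0 <= n%:R * (1 - cfRe xi (s / a n)) by rewrite mulr_ge0.
have h1 : 4 ^+ k * (n%:R * (1 - cfRe xi (s / a n))) <= (2 * t ^+ 2 + 4) * w ^+ 2.
  apply: (@le_trans _ _ (4 * w ^+ 2 * (t ^+ 2 / 2 + 1))); last by lra.
  by apply: ler_pM => //; rewrite exprn_ge0.
rewrite E; split.
  have := Rintegral_cos_doubling P k mX.
  under [X in 1 - X <= _]eq_Rintegral do rewrite mulrA.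
  rewrite -/(cfRe xi _) -/(cfRe xi _) => h.
  by apply: le_trans h1; rewrite [leRHS]mulrCA ler_wpM2l.
have := Rintegral_sin_doubling P k mX.
under [X in `|X| <= _]eq_Rintegral do rewrite mulrA.
rewrite -/(cfRe xi _) -/(cfIm xi _) -/(cfIm xi _) => h.
have h2 : 2 ^+ k * (n%:R * `|cfIm xi (s / a n)|) <= 4 * w ^+ 2 * 1.
  by apply: ler_pM => //; rewrite ?mulr_ge0 ?exprn_ge0.
apply: (@le_trans _ _ (n%:R * (2 ^+ k * `|cfIm xi (s / a n)| +
  4 ^+ k * (1 - cfRe xi (s / a n))))); first by rewrite ler_wpM2l.
lra.
Qed.

(** Comparison of a single factor. Weights up to [c] fall under the uniform convergence on a compact
    set; larger ones are bounded by [cf_growth], the Gaussian factor adding at most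
    [t ^ 2 / 2 * w ^ 2]. The coefficients of [w ^ 2] sum to at most [5 * t ^ 2 + 12]. *)
Lemma cf_gauss_approx (t c e : R) : 1 <= c -> 0 < e ->
  \forall n \near \oo, forall w : R,
  n%:R * (`|cfRe xi (t * w / a n) - expR (- (t ^+ 2 / 2 * (w ^+ 2 / n%:R)))| +
     `|cfIm xi (t * w / a n)|) <=
  e + (5 * t ^+ 2 + 12) * (w ^+ 2 * (c < `|w|)%R%:R).
Proof.
move=> c1 e0.
pose K := `|t| * c + 1.
have tc0 : 0 <= `|t| * c by rewrite mulr_ge0// (le_trans ler01).
have K0 : 0 < K by rewrite ltr_wpDl.
have e40 : 0 < e / 4 by rewrite divr_gt0.
have nS := cf_scaled_cvg xi_iid clt K0 e40.
have nG := cf_growth t.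
near=> n => w.
have n1 : 1 <= n%:R :> R by near: n; exact: nbhs_infty_ger.
have n2 : K ^+ 2 <= n%:R by near: n; exact: nbhs_infty_ger.
have n3 : 2 * K ^+ 4 / e <= n%:R by near: n; exact: nbhs_infty_ger.
have hS : forall t, `|t| <= K ->
    `|n%:R * (1 - cfRe xi (t / a n)) - t ^+ 2 / 2| <= e / 4 /\
    n%:R * `|cfIm xi (t / a n)| <= e / 4 by near: n.
have hG : forall w, 1 <= `|w| ->
  n%:R * (1 - cfRe xi (t * w / a n)) <= (2 * t ^+ 2 + 4) * w ^+ 2 /\
  n%:R * `|cfIm xi (t * w / a n)| <= (2 * t ^+ 2 + 8) * w ^+ 2 by near: n.
have n0 : 0 < n%:R :> R by exact: lt_le_trans n1.
set y := t ^+ 2 / 2 * (w ^+ 2 / n%:R).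
have y0 : 0 <= y by rewrite mulr_ge0 ?divr_ge0 ?sqr_ge0// ltW.
have ny : n%:R * y = (t * w) ^+ 2 / 2 by rewrite /y; field; rewrite gt_eqF.
set A := cfRe xi _; set B := cfIm xi _.
rewrite mulrDr -[X in X * `|A - _|](gtr0_norm n0) -normrM.
have [wc|wc] := ltP c `|w|.
  rewrite mulr1.
  have [GA GB] := hG w (le_trans c1 (ltW wc)).
  have A1 : A <= 1 by exact: cfRe_le1.
  have ey1 : expR (- y) <= 1 by rewrite -expR0 ler_expR oppr_le0.
  have eyy : 1 - y <= expR (- y) by exact: expR_ge1Dx.
  have : `|n%:R * (A - expR (- y))| <= n%:R * (1 - A) + n%:R * y.
    rewrite normrM (gtr0_norm n0) -mulrDr ler_wpM2l ?(ltW n0)//.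
    by rewrite ler_norml; apply/andP; split; lra.
  rewrite ny exprMn; have := mulr_ge0 (sqr_ge0 t) (sqr_ge0 w).
  by move: GA GB; rewrite -/A -/B; lra.
rewrite /= mulr0n !mulr0 addr0.
have twK : `|t * w| <= K.
  rewrite normrM; apply: (@le_trans _ _ (`|t| * c)); first by rewrite ler_wpM2l.
  by rewrite lerDl.
have [] := hS _ twK; rewrite -/A -/B -ny => hA hB.
have yK : n%:R * y <= K ^+ 2 / 2.
  rewrite ny ler_pM2r// -(real_normK (num_real (t * w))).
  by rewrite ler_sqr ?nnegrE// ltW.
have y12 : `|- y| <= 1 / 2.
  rewrite normrN ger0_norm// -(ler_pM2l n0).
  by apply: (le_trans yK); lra.
have := expR_quadratic y12; rewrite sqrrN opprK => hy.
have hy2 : n%:R * `|expR (- y) - 1 + y| <= e / 4.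
  apply: (@le_trans _ _ (n%:R * (2 * y ^+ 2))); first by rewrite ler_wpM2l// ltW.
  have -> : n%:R * (2 * y ^+ 2) = 2 * (n%:R * y) ^+ 2 / n%:R.
    by field; rewrite gt_eqF.
  rewrite ler_pdivrMr//.
  have h : (n%:R * y) ^+ 2 <= (K ^+ 2 / 2) ^+ 2.
    have ny0 : 0 <= n%:R * y by rewrite mulr_ge0// ltW.
    by rewrite ler_sqr ?nnegrE// (le_trans ny0).
  have h' : (K ^+ 2 / 2) ^+ 2 = K ^+ 4 / 4 by field.
  have h3 : 2 * K ^+ 4 <= n%:R * e by rewrite -ler_pdivrMr.
  rewrite h' in h; lra.
have -> : n%:R * (A - expR (- y)) =
   - (n%:R * (1 - A) - n%:R * y) - n%:R * (expR (- y) - 1 + y) by ring.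
have := ler_normB (- (n%:R * (1 - A) - n%:R * y)) (n%:R * (expR (- y) - 1 + y)).
rewrite normrN; move: hy2; rewrite -[X in X * _](gtr0_norm n0) -normrM.
move: hA hB; lra.
Unshelve. all: by end_near. Qed.

(** The factorwise errors of [cf_gauss_approx], divided by [n] and summed over the row. The
    threshold on [n] is uniform in the weights, so the estimate can later be integrated over random
    ones. *)
Lemma weighted_sum_cf (t c e : R) : 1 <= c -> 0 < e ->
  \forall n \near \oo, forall (w : nat -> R) x,
  `|\int[P]_v cos (x + t * ((a n)^-1 * \sum_(k < n) w k * xi k v)) -
    cos x * expR (- (t ^+ 2 / 2 * (n%:R^-1 * \sum_(k < n) w k ^+ 2)))| <=
  e + (5 * t ^+ 2 + 12) * (n%:R^-1 * \sum_(k < n) w k ^+ 2 * (c < `|w k|)%R%:R).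
Proof.
move=> c1 e0; have nA := cf_gauss_approx t c1 e0.
near=> n => w x.
have n0 : 0 < n%:R :> R by rewrite ltr0n; near: n; exact: nbhs_infty_gt.
have hA : forall w : R,
  n%:R * (`|cfRe xi (t * w / a n) - expR (- (t ^+ 2 / 2 * (w ^+ 2 / n%:R)))| +
     `|cfIm xi (t * w / a n)|) <=
  e + (5 * t ^+ 2 + 12) * (w ^+ 2 * (c < `|w|)%R%:R) by near: n.
pose u k := t * w k / a n.
pose z k := expR (- (t ^+ 2 / 2 * (w k ^+ 2 / n%:R))).
have z01 k : 0 <= z k <= 1.
  rewrite expR_ge0/= -expR0 ler_expR oppr_le0.
  by rewrite mulr_ge0 ?divr_ge0 ?sqr_ge0// ltW.
have := cos_lin_comb_bound xi_iid.1 u n x z01.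
have -> : \prod_(k < n) z k = expR (- (t ^+ 2 / 2 * (n%:R^-1 * \sum_(k < n) w k ^+ 2))).
  rewrite mulr_sumr mulr_sumr -sumrN expR_sum; apply: eq_bigr => k _.
  by rewrite /z [n%:R^-1 * _]mulrC.
have -> : \int[P]_v cos (x + \sum_(k < n) u k * xi k v) =
    \int[P]_v cos (x + t * ((a n)^-1 * \sum_(k < n) w k * xi k v)).
  apply: eq_Rintegral => v _; rewrite mulr_sumr mulr_sumr; congr (cos (_ + _)).
  by apply: eq_bigr => k _; rewrite /u; ring.
move=> h; apply: (le_trans h).
have -> : e + (5 * t ^+ 2 + 12) * (n%:R^-1 * \sum_(k < n) w k ^+ 2 * (c < `|w k|)%R%:R) =
   \sum_(k < n) n%:R^-1 * (e + (5 * t ^+ 2 + 12) * (w k ^+ 2 * (c < `|w k|)%R%:R)).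
  rewrite -mulr_sumr big_split/= mulrDr; congr (_ + _).
    by rewrite sumr_const card_ord -[e *+ n]mulr_natl mulKf// gt_eqF.
  by rewrite -mulr_sumr mulrCA.
apply: ler_sum => k _; rewrite -(ler_pM2l n0) mulVKf ?gt_eqF//.
apply: le_trans (hA (w k)).
rewrite (@identically_distributed_Rintegral _ _ _ _ _ (fun v => cos (u k * v)) k 1 xi_iid.2).
- rewrite (@identically_distributed_Rintegral _ _ _ _ _ (fun v => sin (u k * v)) k 1 xi_iid.2)//.
  + by apply: measurable_sin_comp; exact: measurable_funM.
  + by move=> v; exact: sin_max.
- by apply: measurable_cos_comp; exact: measurable_funM.
- by move=> v; exact: cos_max.
Unshelve. all: by end_near. Qed.

End weighted_sums.

(** * Random weights *)

Section sigma_families.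
Context (R : realType) (d : measure_display) (T : measurableType d) (P : probability T R).

(** The generator of [sigma_of_family], named so that [T] can carry the sigma-algebra of one family
    as a measurable type. *)
Definition family_preimages (I : Type) (X : I -> {RV P >-> R}) : set_system T :=
  \bigcup_i preimage_set_system setT (X i) measurable.

Lemma family_preimages_measurable (I : Type) (X : I -> {RV P >-> R}) :
  measurable_fun setT (id : T -> g_sigma_algebraType (family_preimages X)).
Proof.
move=> _ A mA; rewrite setTI preimage_id.
have : <<s family_preimages X >> `<=` measurable.
  apply: smallest_sub; first exact: sigma_algebra_measurable.
  move=> B [i _ [C mC <-]]; rewrite setTI.
  by rewrite -[X in measurable X]setTI; exact: measurable_funP.
by apply.
Qed.

Lemma measurable_family_member (I : Type) (X : I -> {RV P >-> R}) i :
  measurable_fun setT (X i : g_sigma_algebraType (family_preimages X) -> R).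
Proof.
move=> _ A mA; rewrite setTI; apply: sub_sigma_algebra.
by exists i => //; exists A => //; rewrite setTI.
Qed.

(** [indep_Rintegral] applied to two copies of the identity of [T], one for the sigma-algebra of
    each family: independence of the families is independence of these two maps. *)
Lemma independent_families_Rintegral (I J : Type) (X : I -> {RV P >-> R})
    (Y : J -> {RV P >-> R}) (F : T -> T -> R) (M : R) :
  independent_families X Y ->
  measurable_fun setT (fun z : g_sigma_algebraType (family_preimages X) *
     g_sigma_algebraType (family_preimages Y) => F z.1 z.2) ->
  (forall u v, `|F u v| <= M) ->
  \int[P]_w F w w = \int[P]_u \int[P]_v F u v.
Proof.
move=> XY mF FM.
apply: (@indep_Rintegral R d T P
  _ (g_sigma_algebraType (family_preimages X))
  _ (g_sigma_algebraType (family_preimages Y)) id id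
  (@family_preimages_measurable _ X) (@family_preimages_measurable _ Y) _
  (fun z => F z.1 z.2) M mF) => [A B mA mB|z].
  by rewrite !preimage_id; exact: XY.
exact: FM.
Qed.

End sigma_families.

(** Independence freezes [W] at a value [W u], and [normal_cf] at frequency [t * Num.sqrt (W u)]
    evaluates the integral over [N]. *)
Lemma mixed_normal_cf (R : realType) (d : measure_display) (T : measurableType d)
    (P : probability T R) (W N : {RV P >-> R}) (x t : R) :
  (forall w, 0 <= W w) -> standard_normal N -> independent_RV2 W N ->
  \int[P]_w cos (x + t * (Num.sqrt (W w) * N w)) =
  \int[P]_w (cos x * expR (- (t ^+ 2 / 2 * W w))).
Proof.
move=> W0 Nn WN.
have msqrt : measurable_fun setT (@Num.sqrt R).
  by apply: continuous_measurable_fun; exact: sqrt_continuous.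
pose F (z : R * R) := cos (x + t * (Num.sqrt z.1 * z.2)).
have mF : measurable_fun setT F.
  apply: measurable_cos_comp; apply: measurable_funD => //.
  apply: measurable_funM => //; apply: measurable_funM => //.
  exact: measurableT_comp.
transitivity (\int[P]_u \int[P]_v F (W u, N v)).
  exact: (indep_Rintegral (measurable_funPT W) (measurable_funPT N) WN mF
    (M := 1) (fun z => cos_max _)).
apply: eq_Rintegral => u _.
pose f (v : R) := cos (x + t * Num.sqrt (W u) * v).
have mf : measurable_fun setT f.
  by apply: measurable_cos_comp; apply: measurable_funD => //; exact: measurable_funM.
transitivity (\int[P]_v f (N v)).
  by apply: eq_Rintegral => v _; rewrite /F /f/= mulrA.
transitivity (\int[normal_prob 0 1]_v f v).
  rewrite /Rintegral; congr fine.
  have mN : measurable_fun setT (N : T -> measurableTypeR R) by exact: measurable_funPT N.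
  transitivity (\int[pushforward P (N : T -> measurableTypeR R)]_v (f v)%:E)%E.
    rewrite (@integral_pushforward _ _ _ _ _ _ mN P setT (EFin \o f))//.
      exact/measurable_EFinP.
    apply: (bounded_integrable P (M := 1) (f := f \o N)); first exact: measurableT_comp.
    by move=> v; exact: cos_max.
  by apply: eq_measure_integral => A mA _; exact: Nn.
rewrite normal_cf; congr (_ * expR (- _)).
by rewrite exprMn sqr_sqrtr// mulrAC.
Qed.

Section random_weights.
Context (R : realType) (d : measure_display) (T : measurableType d) (P : probability T R).
Variables (xi : nat -> {RV P >-> R}) (W_ : triangular_array P) (a : nat -> R).
Arguments W_ : clear implicits.
Hypothesis xi_iid : iid xi.
Hypothesis W_indep_xi : independent_families (array_entry W_) xi.
Hypothesis clt : cvg_in_distribution P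
  (fun n w => (a n)^-1 * \sum_(k < n) xi k w) (normal_prob 0 1) idfun.

(** The random variable whose expectation [sup_tail_second_moment] bounds over the rows; the
    indicator is a coerced boolean, to match [weighted_sum_cf]. *)
Definition row_tail n (c : R) (u : T) : R :=
  n%:R^-1 * \sum_(k < n) W_ n k u ^+ 2 * (c < `|W_ n k u|)%R%:R.

Lemma row_tail_ge0 n c u : 0 <= row_tail n c u.
Proof.
rewrite mulr_ge0 ?invr_ge0//; apply: sumr_ge0 => k _.
by rewrite mulr_ge0 ?sqr_ge0.
Qed.

Let indicE_tail n (k : 'I_n) c u : (c < `|W_ n k u|)%R%:R =
  \1_[set v | c < `|W_ n k v|] u :> R.
Proof. by rewrite indicE; congr (_%:R); congr nat_of_bool; apply/idP/idP; rewrite in_setE. Qed.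

Let measurable_tail_term n (k : 'I_n) c :
  measurable_fun setT (fun u => W_ n k u ^+ 2 * \1_[set v | c < `|W_ n k v|] u).
Proof.
apply: measurable_funM; first exact: measurable_funX.
apply: measurable_indic.
rewrite -[X in measurable X]setTI.
apply: measurable_fun_ltr => //.
exact: measurableT_comp.
Qed.

Lemma measurable_row_tail n c : measurable_fun setT (row_tail n c).
Proof.
apply: measurable_funM => //; apply: measurable_sum => k.
by under eq_fun do rewrite indicE_tail; exact: measurable_tail_term.
Qed.

Lemma row_tail_integral_le n c : (0 < n)%N ->
  (\int[P]_u (row_tail n c u)%:E <= sup_tail_second_moment W_ c)%E.
Proof.
move=> n0; apply: ereal_sup_ubound; exists n => //.
rewrite /row_tail; under [RHS]eq_integral do rewrite EFinM.
rewrite ge0_integralZl//; last 2 first.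
- apply/measurable_EFinP; apply: measurable_sum => k.
  by under eq_fun do rewrite indicE_tail; exact: measurable_tail_term.
- move=> u _; rewrite lee_fin; apply: sumr_ge0 => k _.
  by rewrite mulr_ge0 ?sqr_ge0.
congr (_ * _)%E.
under [RHS]eq_integral do rewrite -sumEFin.
rewrite ge0_integral_sum//; last 2 first.
- move=> k; apply/measurable_EFinP.
  by under eq_fun do rewrite indicE_tail; exact: measurable_tail_term.
- by move=> k u _; rewrite lee_fin mulr_ge0 ?sqr_ge0.
apply: eq_bigr => k _; rewrite unlock; apply: eq_integral => u _.
by rewrite indicE_tail.
Qed.

Let Xn n w := (a n)^-1 * \sum_(k < n) W_ n k w * xi k w.
Let Vn n w := n%:R^-1 * \sum_(k < n) W_ n k w ^+ 2.

Lemma measurable_weighted_sum n : measurable_fun setT (Xn n).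
Proof.
apply: measurable_funM => //; apply: measurable_sum => k.
exact: measurable_funM.
Qed.

Lemma measurable_row_square n : measurable_fun setT (Vn n).
Proof.
apply: measurable_funM => //; apply: measurable_sum => k.
exact: measurable_funX.
Qed.

(** Independence freezes the weights, [weighted_sum_cf] applies to each frozen row, and integrating
    over the weights replaces the row tail by its expectation, at most [dl]. *)
Lemma random_weighted_sum_cf (t c e dl x : R) : 1 <= c -> 0 < e ->
  (sup_tail_second_moment W_ c <= dl%:E)%E ->
  \forall n \near \oo,
  `|\int[P]_w cos (x + t * Xn n w) -
    \int[P]_w (cos x * expR (- (t ^+ 2 / 2 * Vn n w)))| <=
  e + (5 * t ^+ 2 + 12) * dl.
Proof.
move=> c1 e0 supc; have nA := weighted_sum_cf xi_iid clt t c1 e0.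
near=> n.
have n0 : (0 < n)%N by near: n; exact: nbhs_infty_gt.
have hA : forall (w : nat -> R) x,
  `|\int[P]_v cos (x + t * ((a n)^-1 * \sum_(k < n) w k * xi k v)) -
    cos x * expR (- (t ^+ 2 / 2 * (n%:R^-1 * \sum_(k < n) w k ^+ 2)))| <=
  e + (5 * t ^+ 2 + 12) * (n%:R^-1 * \sum_(k < n) w k ^+ 2 * (c < `|w k|)%R%:R).
  by near: n.
pose F u v := cos (x + t * ((a n)^-1 * \sum_(k < n) W_ n k u * xi k v)).
have -> : \int[P]_w cos (x + t * Xn n w) = \int[P]_u \int[P]_v F u v.
  apply: (independent_families_Rintegral (M := 1) W_indep_xi); last first.
    by move=> u v; exact: cos_max.
  apply: measurable_cos_comp; apply: measurable_funD => //.
  apply: measurable_funM => //; apply: measurable_funM => //.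
  apply: measurable_sum => k; apply: measurable_funM.
    apply: (measurableT_comp _ measurable_fst).
    exact: (measurable_family_member (X := array_entry W_) (existT (fun n => 'I_n) n k)).
  apply: (measurableT_comp _ measurable_snd).
  exact: (measurable_family_member (X := xi) k).
have hB u : `|\int[P]_v F u v - cos x * expR (- (t ^+ 2 / 2 * Vn n u))| <=
    e + (5 * t ^+ 2 + 12) * row_tail n c u.
  (* The row is extended by 0 to a sequence on all of [nat]; the sums only see indices below [n]. *)
  pose w (k : nat) := if insub k is Some i then W_ n i u else 0.
  have wE (k : 'I_n) : w k = W_ n k u by rewrite /w valK.
  have := hA w x.
  under eq_Rintegral do under eq_bigr do rewrite wE.
  under eq_bigr do rewrite wE.
  by under [X in _ <= _ + _ * (_ * X)]eq_bigr do rewrite wE.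
have mIF : measurable_fun setT (fun u => \int[P]_v F u v).
  apply: (measurable_bounded_Rintegral P P (F := fun z => F z.2 z.1) (M := 1)).
    apply: measurable_cos_comp; apply: measurable_funD => //.
    apply: measurable_funM => //; apply: measurable_funM => //.
    by apply: measurable_sum => k; apply: measurable_funM; exact: measurableT_comp.
  by move=> z; exact: cos_max.
have iIF : P.-integrable setT (EFin \o (fun u => \int[P]_v F u v)).
  apply: (bounded_integrable P mIF (M := 1)) => u.
  apply: Rintegral_cos_max; apply: measurable_funD => //.
  by do 2 apply: measurable_funM => //; apply: measurable_sum => k; exact: measurable_funM.
have mE : measurable_fun setT (fun u => cos x * expR (- (t ^+ 2 / 2 * Vn n u))).
  apply: measurable_funM => //; apply: measurableT_comp => //.
  by apply: measurableT_comp => //; apply: measurable_funM => //; exact: measurable_row_square.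
have iE : P.-integrable setT (EFin \o (fun u => cos x * expR (- (t ^+ 2 / 2 * Vn n u)))).
  apply: (bounded_integrable P mE (M := 1)) => u.
  rewrite normrM mulr_ile1 ?cos_max//.
  rewrite ger0_norm ?expR_ge0// -expR0 ler_expR oppr_le0.
  by rewrite mulr_ge0 ?divr_ge0 ?sqr_ge0// mulr_ge0 ?invr_ge0// sumr_ge0// => k _; rewrite sqr_ge0.
have tail_le := le_trans (row_tail_integral_le c n0) supc.
have iT : P.-integrable setT (EFin \o row_tail n c).
  apply/integrableP; split; first exact/measurable_EFinP/measurable_row_tail.
  under eq_integral do rewrite /= ger0_norm ?row_tail_ge0//.
  by rewrite (le_lt_trans tail_le)// ltry.
have iB := integrable_EFinB measurableT iIF iE.
have ie : P.-integrable setT (EFin \o cst e) by exact: (bounded_integrable P (M := `|e|)).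
have iCT := integrable_EFinZl measurableT (5 * t ^+ 2 + 12) iT.
rewrite -RintegralB//; apply: (le_trans (le_normr_Rintegral _ iB)) => //.
apply: (@le_trans _ _ (\int[P]_u (cst e u + (5 * t ^+ 2 + 12) * row_tail n c u))).
  apply: le_Rintegral => //.
  - exact: integrable_norm iB.
  - exact: integrable_EFinD ie iCT.
rewrite RintegralD// (Rintegral_cstT P e) lerD2l RintegralZl//.
rewrite ler_wpM2l//; first by rewrite addr_ge0// mulr_ge0// sqr_ge0.
rewrite /Rintegral -lee_fin fineK//.
exact: (integrable_fin_num measurableT iT).
Unshelve. all: by end_near. Qed.

End random_weights.

Theorem theorem2p2 (R : realType)
    (d : measure_display) (T : measurableType d) (P : probability T R)
    (xi : nat -> {RV P >-> R}) (W_ : triangular_array P)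
    (d' : measure_display) (T' : measurableType d') (P' : probability T' R)
    (W N : {RV P' >-> R}) (a : nat -> R)
    (xi_iid : iid xi)
    (W_indep_xi : independent_families (array_entry W_) xi)
    (W_ge0 : forall w : T', 0 <= W w)
    (A3 : cvg_in_distribution P
            (fun n w => n%:R^-1 * \sum_(k < n) W_ n k w ^+ 2) P' W)
    (A4 : sup_tail_second_moment W_ c @[c --> +oo] --> 0%E)
    (a_gt0 : forall n : nat, (0 < n)%N -> 0 < a n)
    (clt : cvg_in_distribution P
             (fun n w => (a n)^-1 * \sum_(k < n) xi k w)
             (normal_prob 0 1) idfun)
    (N_normal : standard_normal N)
    (W_indep_N : independent_RV2 W N) :
  cvg_in_distribution P
    (fun n w => (a n)^-1 * \sum_(k < n) W_ n k w * xi k w)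
    P' (fun w => Num.sqrt (W w) * N w).
Proof.
apply: cvg_in_distribution_cf.
- exact: measurable_weighted_sum.
- apply: measurable_funM => //.
  apply: measurableT_comp => //.
  by apply: continuous_measurable_fun; exact: sqrt_continuous.
move=> x t; rewrite mixed_normal_cf//.
(* The absolute value keeps this test function bounded on the negative axis; it changes nothing at
   [W w] or at the row averages of squares, which are nonnegative. *)
pose f (v : R) := cos x * expR (- (t ^+ 2 / 2 * `|v|)).
have cf : continuous f.
  move=> v; apply: cvgMr.
  apply: continuous_cvg; first exact: continuous_expR.
  by apply: cvgN; apply: cvgMr; exact: norm_continuous.
have f1 v : `|f v| <= 1.
  rewrite normrM mulr_ile1 ?cos_max//.
  rewrite ger0_norm ?expR_ge0// -expR0 ler_expR oppr_le0.
  by rewrite mulr_ge0 ?divr_ge0 ?sqr_ge0.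
have := (cvg_in_distributionP P P' (measurable_row_square W_) (measurable_funPT W)).1 A3 f 1 cf f1.
have -> : \int[P']_w f (W w) = \int[P']_w (cos x * expR (- (t ^+ 2 / 2 * W w))).
  by apply: eq_Rintegral => w _; rewrite /f ger0_norm.
move=> cvgV; apply/cvgrPdist_le => e e0.
have C0 : 0 < 5 * t ^+ 2 + 12 by rewrite ltr_wpDl// mulr_ge0// sqr_ge0.
have e30 : 0 < e / 3 by rewrite divr_gt0.
(* The tail of the weights, the comparison for bounded weights and the convergence in law of the row
   averages will contribute [e / 3] each. *)
pose dl := e / 3 / (5 * t ^+ 2 + 12).
have dl0 : 0 < dl by rewrite divr_gt0.
have [c [c1 supc]] : exists c : R, 1 <= c /\ (sup_tail_second_moment W_ c <= dl%:E)%E.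
  have : \forall c \near +oo, 1 <= c /\ (sup_tail_second_moment W_ c <= dl%:E)%E.
    have nb : nbhs 0%E [set y : \bar R | (y < dl%:E)%E].
      by apply: open_nbhs_nbhs; split; [exact: open_ereal_lt_ereal|rewrite /= lte_fin].
    have H : \forall c \near +oo, (sup_tail_second_moment W_ c < dl%:E)%E := A4 _ nb.
    by near=> c; split; [near: c; exact: nbhs_pinfty_ge|apply: ltW; near: c].
  by move=> /filter_ex.
have nX := random_weighted_sum_cf xi_iid W_indep_xi clt t x c1 e30 supc.
move/cvgrPdist_le : cvgV => /(_ _ e30) nV.
near=> n.
have h1 : `|\int[P]_w cos (x + t * ((a n)^-1 * \sum_(k < n) W_ n k w * xi k w)) -
    \int[P]_w (cos x * expR (- (t ^+ 2 / 2 * (n%:R^-1 * \sum_(k < n) W_ n k w ^+ 2))))| <=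
    e / 3 + (5 * t ^+ 2 + 12) * dl by near: n.
have h2 : `|\int[P']_w (cos x * expR (- (t ^+ 2 / 2 * W w))) -
     \int[P]_w f (n%:R^-1 * \sum_(k < n) W_ n k w ^+ 2)| <= e / 3 by near: n.
have E : \int[P]_w f (n%:R^-1 * \sum_(k < n) W_ n k w ^+ 2) =
  \int[P]_w (cos x * expR (- (t ^+ 2 / 2 * (n%:R^-1 * \sum_(k < n) W_ n k w ^+ 2)))).
  apply: eq_Rintegral => w _; rewrite /f ger0_norm// mulr_ge0 ?invr_ge0//.
  by apply: sumr_ge0 => k _; rewrite sqr_ge0.
have dlE : (5 * t ^+ 2 + 12) * dl = e / 3 by rewrite /dl mulrC divfK// gt_eqF.
move: h1 h2; rewrite E dlE.
set u := \int[P]_w cos _; set v := \int[P]_w (_ * _); set z := \int[P']_w _.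
rewrite distrC => h1 h2.
by apply: (le_trans (ler_distD v z u)); lra.
Unshelve. all: by end_near. Qed.
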